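(* Let $F:\mathbb{R}^p\times\mathbb{R}^m\to\mathbb{R}^p$ be locally Lipschitz and path differentiable, jointly in $(x,\theta)$, and let $J_F:\mathbb{R}^p\times\mathbb{R}^m\rightrightarrows\mathbb{R}^{p\times(p+m)}$ be a conservative Jacobian for $F$. Assume there exists $0\le\rho<1$ such that for every $(x,\theta)$ and every $[A,B]\in J_F(x,\theta)$, with $A\in\mathbb{R}^{p\times p}$ and $B\in\mathbb{R}^{p\times m}$, one has $\|A\|_{\mathrm{op}}\le\rho$. Let $x_0:\mathbb{R}^m\to\mathbb{R}^p$ be Lipschitz, define $x_{k+1}(\theta)=F(x_k(\theta),\theta)$ for $k\in\mathbb{N}$, $\theta\in\mathbb{R}^m$, and let $\bar x(\theta)$ be the unique fixed point of $F(\cdot,\theta)$. Then for (Lebesgue) almost all $\theta\in\mathbb{R}^m$, the classical Jacobian $\frac{\partial}{\partial\theta}x_k(\theta)$ is well defined for all $k$ and converges towards the classical Jacobian of $\bar x$: $$\lim_{k\to\infty}\frac{\partial}{\partial\theta}x_k(\theta)=\frac{\partial}{\partial\theta}\bar x(\theta).$$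
   Context: Conservative Jacobian: for a locally Lipschitz $f:\mathbb{R}^n\to\mathbb{R}^q$, a set-valued map $J:\mathbb{R}^n\rightrightarrows\mathbb{R}^{q\times n}$ is a conservative Jacobian for $f$ if it has closed graph, is locally bounded, is nowhere empty, and for every absolutely continuous $\gamma:[0,1]\to\mathbb{R}^n$, for almost every $t\in[0,1]$, $\frac{d}{dt}f(\gamma(t))=V\dot\gamma(t)$ for all $V\in J(\gamma(t))$. $f$ is path differentiable if it admits a conservative Jacobian. $[A,B]$ is the concatenation of $A$ and $B$; $\|\cdot\|_{\mathrm{op}}$ is the operator norm induced by the Euclidean norm. The contraction hypothesis implies that $F(\cdot,\theta)$ is a strict contraction, so it has a unique fixed point. *)

(* Defs.v *)
(* MathComp-Analysis, over an arbitrary [R : realType]. Vectors of R^n are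
   columns ['cV[R]_n]. The norm [`|_|] on columns and matrices is the library's
   max norm; it occurs only in notions (Lipschitz, bounded, absolutely
   continuous, closed, differentiable) that are the same for all norms. *)
From mathcomp Require Export all_boot all_order all_algebra.
From mathcomp Require Export all_classical all_reals all_analysis.

Set Implicit Arguments.
Unset Strict Implicit.
Unset Printing Implicit Defensive.

Export Order.TTheory GRing.Theory Num.Theory.
Export numFieldNormedType.Exports.

Local Open Scope classical_set_scope.
Local Open Scope ring_scope.

Section vectors.
Context {R : realType}.

Definition norm2 n (v : 'cV[R]_n) : R := Num.sqrt (\sum_i v i 0 ^+ 2).

Definition opnorm q n (A : 'M[R]_(q, n)) : R :=
  sup [set norm2 (A *m v) | v in [set v : 'cV[R]_n | norm2 v <= 1]].

(* The library's [jacobian] acts on row vectors and is the transpose of this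
   one. It is meaningful where [f] is [differentiable]. *)
Definition Jacobian n q (f : 'cV[R]_n -> 'cV[R]_q) (x : 'cV[R]_n) :
    'M[R]_(q, n) :=
  \matrix_(i, j) ('D_(delta_mx j 0) f x) i 0.

Definition locally_lipschitz n q (f : 'cV[R]_n -> 'cV[R]_q) : Prop :=
  forall x : 'cV[R]_n, exists2 U, nbhs x U & [lipschitz f y | y in U].

(* Lebesgue measure on R^n as an iterated product. It lives on [n.-tuple R],
   which the library equips with the product of the Borel sigma-algebras. *)
Fixpoint lebesgue_tuple n : set (n.-tuple (measurableTypeR R)) -> \bar R :=
  match n with
  | 0 => dirac [tuple]
  | n'.+1 => pushforward
      (product_measure1 lebesgue_measure (@lebesgue_tuple n'))
      (fun z => [tuple of z.1 :: z.2])
  end.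

Definition col_of_tuple n (t : n.-tuple R) : 'cV[R]_n := \col_i tnth t i.

End vectors.

Section conservative_jacobian.
Context {R : realType}.

Definition absolutely_continuous01 n (gamma : R -> 'cV[R]_n) : Prop :=
  forall e : R, 0 < e -> exists2 d : R, 0 < d &
    forall (N : nat) (a b : 'I_N -> R),
      (forall i, 0 <= a i /\ a i <= b i /\ b i <= 1) ->
      trivIset [set: 'I_N] (fun i => `]a i, b i[%classic) ->
      \sum_i (b i - a i) < d ->
      \sum_i `|gamma (b i) - gamma (a i)| < e.

(* A curve on [0, 1] is represented by a function on R whose values outside
   [0, 1] are irrelevant: almost every t lies in the interior, where the
   derivatives only depend on the values in [0, 1]. *)
Definition chain_rule_along_curves n q (f : 'cV[R]_n -> 'cV[R]_q)
    (J : 'cV[R]_n -> set 'M[R]_(q, n)) : Prop :=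
  forall gamma : R -> 'cV[R]_n, absolutely_continuous01 gamma ->
    {ae (@lebesgue_measure R), forall t : R, t \in `[0, 1] ->
      derivable gamma t 1 /\
      forall V, J (gamma t) V ->
        is_derive t 1 (f \o gamma) (V *m 'D_1 gamma t)}.

Definition conservative_jacobian n q (f : 'cV[R]_n -> 'cV[R]_q)
    (J : 'cV[R]_n -> set 'M[R]_(q, n)) : Prop :=
  [/\ closed [set z : 'cV[R]_n * 'M[R]_(q, n) | J z.1 z.2],
      forall x : 'cV[R]_n, exists2 U, nbhs x U & bounded_set (\bigcup_(y in U) J y),
      forall x, J x !=set0
    & chain_rule_along_curves f J].

Definition path_differentiable n q (f : 'cV[R]_n -> 'cV[R]_q) : Prop :=
  exists J, conservative_jacobian f J.

End conservative_jacobian.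

(* R^p x R^m is identified with R^(p + m) through [col_mx]. *)
Definition iterates (R : realType) (p m : nat)
    (F : 'cV[R]_(p + m) -> 'cV[R]_p) (x0 : 'cV[R]_m -> 'cV[R]_p)
    (k : nat) (theta : 'cV[R]_m) : 'cV[R]_p :=
  iter k (fun x => F (col_mx x theta)) (x0 theta).

(* Main.v *)
(* Directional derivatives obey the recursion [D_(k+1) = A_k D_k + B_k e] for any
   [[A_k, B_k]] in [JF (x_k, theta)], by the chain rule along coordinate lines and
   Fubini; this needs no path differentiability of [x0], only that it is Lipschitz.
   Likewise [D = A D + B e] for all [[A, B]] in [JF (xbar, theta)]. Hence
   [D_(k+1) - D = A_k (D_k - D) + (A_k D + B_k e - D)], where [A_k] contracts by
   [rho] and the last term tends to 0 because [JF] has closed graph and is locally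
   bounded. The bound [|A| <= rho], integrated along segments with [theta] fixed,
   makes [F (., theta)] a [rho]-contraction in the Euclidean norm.

   Almost everywhere differentiability of locally Lipschitz maps (Rademacher) is
   obtained without integration. Derivatives along coordinate lines exist almost
   everywhere, as [JF] grants this for absolutely continuous curves. The points
   where differentiability along a coordinate subspace and along one further axis
   do not combine form countably many sets that are porous on each line parallel
   to that axis, hence null by Lebesgue's density theorem and Fubini. *)
From HB Require Import structures.
Require Import Defs.
From mathcomp Require Import ring lra measurable_realfun.

Set Implicit Arguments.
Unset Strict Implicit.
Unset Printing Implicit Defensive.

Local Open Scope classical_set_scope.
Local Open Scope ring_scope.

(** * Euclidean norm *)

Section norm2.
Context {R : realType}.

Definition dot n (u v : 'cV[R]_n) : R := \sum_i u i 0 * v i 0.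

Lemma dotDr n (u v w : 'cV[R]_n) : dot u (v + w) = dot u v + dot u w.
Proof. by rewrite -big_split; apply: eq_bigr => i _; rewrite mxE mulrDr. Qed.

Lemma dotC n (u v : 'cV[R]_n) : dot u v = dot v u.
Proof. by apply: eq_bigr => i _; rewrite mulrC. Qed.

Lemma dotZr n a (u v : 'cV[R]_n) : dot u (a *: v) = a * dot u v.
Proof. by rewrite mulr_sumr; apply: eq_bigr => i _; rewrite mxE mulrCA. Qed.

Lemma dotvv n (v : 'cV[R]_n) : dot v v = norm2 v ^+ 2.
Proof.
rewrite /norm2 sqr_sqrtr; last by apply: sumr_ge0 => i _; exact: sqr_ge0.
by apply: eq_bigr => i _; rewrite expr2.
Qed.

Lemma norm2_ge0 n (v : 'cV[R]_n) : 0 <= norm2 v.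
Proof. exact: sqrtr_ge0. Qed.

(** Cauchy-Schwarz: for nonzero [u], expand the squared norm of [norm2 u ^+ 2 *: v - dot u v *: u],
    which is nonnegative, and cancel [norm2 u ^+ 2]. *)
Lemma dot_le_norm2 n (u v : 'cV[R]_n) : dot u v <= norm2 u * norm2 v.
Proof.
have [u0|u0] := eqVneq (norm2 u) 0.
  suff -> : dot u v = 0 by rewrite u0 mul0r.
  have /(psumr_eq0P (fun i _ => sqr_ge0 (u i 0))) ui0 : \sum_i u i 0 ^+ 2 = 0.
    transitivity (dot u u); last by rewrite dotvv u0 expr0n.
    by apply: eq_bigr => i _; rewrite expr2.
  rewrite /dot big1 // => i _.
  by have /eqP := ui0 i isT; rewrite sqrf_eq0 => /eqP ->; rewrite mul0r.
have up : 0 < norm2 u by rewrite lt_def u0 norm2_ge0.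
have : 0 <= dot (norm2 u ^+ 2 *: v + (- dot u v) *: u)
                (norm2 u ^+ 2 *: v + (- dot u v) *: u).
  by rewrite dotvv sqr_ge0.
rewrite dotDr !dotZr ![dot (_ + _) _]dotC !dotDr !dotZr [dot v u]dotC !dotvv.
set U := norm2 u in u0 up *; set V := norm2 v; set D := dot u v => H.
have V0 : 0 <= V := norm2_ge0 v.
have UV0 : 0 <= U * V := mulr_ge0 (ltW up) V0.
have {}H : D ^+ 2 <= (U * V) ^+ 2.
  rewrite -(ler_pM2l (exprn_gt0 2 up)) -subr_ge0.
  by apply: le_trans H _; rewrite le_eqVlt; apply/orP; left; apply/eqP; ring.
have [D0|D0] := leP D 0; first exact: le_trans D0 UV0.
by move: H; rewrite ler_pXn2r // nnegrE ltW.
Qed.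

Lemma norm2D n (u v : 'cV[R]_n) : norm2 (u + v) <= norm2 u + norm2 v.
Proof.
rewrite -(@ler_pXn2r _ 2) ?nnegrE ?addr_ge0 ?norm2_ge0 //.
rewrite -dotvv dotDr ![dot (_ + _) _]dotC !dotDr !dotvv [dot v u]dotC sqrrD.
by have := dot_le_norm2 u v; lra.
Qed.

Lemma norm2Z n a (v : 'cV[R]_n) : norm2 (a *: v) = `|a| * norm2 v.
Proof.
apply/(@pexpIrn _ 2); rewrite ?nnegrE ?mulr_ge0 ?norm2_ge0 //.
by rewrite -dotvv dotZr dotC dotZr dotvv exprMn real_normK ?num_real //; ring.
Qed.

Lemma norm2_0 n : norm2 (0 : 'cV[R]_n) = 0.
Proof. by rewrite -(scale0r 0) norm2Z normr0 mul0r. Qed.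

Lemma mx_entry_le_norm p n (A : 'M[R]_(p, n)) i j : `|A i j| <= `|A|.
Proof.
rewrite [in leRHS]/Num.norm /= mx_normrE.
exact: (le_bigmax _ (fun ij : 'I_p * 'I_n => `|A ij.1 ij.2|) (i, j)).
Qed.

Lemma mx_norm_le p n (A : 'M[R]_(p, n)) c : 0 <= c ->
  (forall i j, `|A i j| <= c) -> `|A| <= c.
Proof.
move=> c0 Ac; rewrite /Num.norm /= mx_normrE.
by apply/bigmax_leP; split => // -[i j] _ /=.
Qed.

Lemma norm2N n (v : 'cV[R]_n) : norm2 (- v) = norm2 v.
Proof. by rewrite -scaleN1r norm2Z normrN1 mul1r. Qed.

Lemma dotBr n (u v w : 'cV[R]_n) : dot u (v - w) = dot u v - dot u w.
Proof. by rewrite dotDr -scaleN1r dotZr mulN1r. Qed.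

Lemma norm_dot_le n (u v : 'cV[R]_n) : `|dot u v| <= norm2 u * norm2 v.
Proof.
rewrite ler_norml dot_le_norm2 andbT lerNl -mulN1r -dotZr scaleN1r -(norm2N v).
exact: dot_le_norm2.
Qed.

Lemma norm_le_norm2 n (v : 'cV[R]_n) : `|v| <= norm2 v.
Proof.
apply: mx_norm_le => [|i j]; first exact: norm2_ge0.
rewrite (ord1 j) -(@ler_pXn2r _ 2) ?nnegrE ?norm2_ge0 //.
rewrite real_normK ?num_real // -dotvv /dot (bigD1 i) //= -expr2 lerDl.
by apply: sumr_ge0 => k _; rewrite -expr2 sqr_ge0.
Qed.

(** The sharp constant is the square root of [n]; the coarser [n] avoids the root and is harmless
    later. *)
Lemma norm2_le_norm n (v : 'cV[R]_n) : norm2 v <= n%:R * `|v|.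
Proof.
rewrite -(@ler_pXn2r _ 2) ?nnegrE ?mulr_ge0 ?norm2_ge0 //.
rewrite -dotvv exprMn; apply: (@le_trans _ _ (n%:R * `|v| ^+ 2)).
  rewrite /dot (@le_trans _ _ (\sum_(i < n) `|v| ^+ 2)) //.
    apply: ler_sum => i _; rewrite -expr2 -[leLHS]real_normK ?num_real //.
    by rewrite ler_pXn2r ?nnegrE // mx_entry_le_norm.
  by rewrite sumr_const card_ord mulr_natl.
rewrite ler_wpM2r ?sqr_ge0 // -natrX ler_nat.
by case: n v => // n _; rewrite leq_pmulr.
Qed.

Lemma mulmx_norm_le p n q (A : 'M[R]_(p, n)) (B : 'M[R]_(n, q)) :
  `|A *m B| <= n%:R * (`|A| * `|B|).
Proof.
apply: mx_norm_le => [|i j]; first by rewrite !mulr_ge0.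
rewrite mxE (le_trans (ler_norm_sum _ _ _)) //.
rewrite (@le_trans _ _ (\sum_(k < n) (`|A| * `|B|))) //.
  by apply: ler_sum => k _; rewrite normrM ler_pM // mx_entry_le_norm.
by rewrite sumr_const card_ord mulr_natl.
Qed.

(** Besides normalising [v], one must show that the set in [opnorm] is bounded, since only then is
    its [sup] an upper bound. The comparison with the max norm supplies a crude bound. *)
Lemma norm2_mulmx_le_opnorm p n (A : 'M[R]_(p, n)) v :
  norm2 (A *m v) <= opnorm A * norm2 v.
Proof.
have [v0|v0] := eqVneq (norm2 v) 0.
  have -> : v = 0.
    by apply/normr0_eq0/eqP; rewrite eq_le normr_ge0 -v0 norm_le_norm2.
  by rewrite mulmx0 !norm2_0 mulr0.
have vp : 0 < norm2 v by rewrite lt_def v0 norm2_ge0.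
rewrite -ler_pdivrMr //.
have -> : norm2 (A *m v) / norm2 v = norm2 (A *m ((norm2 v)^-1 *: v)).
  by rewrite -scalemxAr norm2Z gtr0_norm ?invr_gt0 // mulrC.
apply: sup_ubound.
  exists (p%:R * (n%:R * (`|A| * 1))) => _ [u u1 <-].
  apply: (le_trans (norm2_le_norm _)); rewrite ler_wpM2l //.
  apply: (le_trans (mulmx_norm_le _ _)); rewrite ler_wpM2l // ler_wpM2l //.
  exact: le_trans (norm_le_norm2 u) u1.
exists ((norm2 v)^-1 *: v) => //=.
by rewrite norm2Z gtr0_norm ?invr_gt0 // mulVf.
Qed.

End norm2.

(** * Lipschitz functions and porosity on the real line *)

Section first_order.
Context {R : realType} {V W : normedModType R}.

(** Directional derivatives as first-order expansions: an estimate without division, valid also at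
    [h = 0], from which closed conditions at a fixed scale can be formed. *)
Lemma is_derive_approxP (f : V -> W) (a v : V) (df : W) :
  (forall e, 0 < e -> exists2 d, 0 < d & forall h : R, `|h| < d ->
    `|f (a + h *: v) - f a - h *: df| <= e * `|h|) <-> is_derive a v f df.
Proof.
split=> [H|[df1 df2] e e0].
  have cv : h^-1 *: ((f \o shift a) (h *: v) - f a) @[h --> (0 : R)^'] --> df.
    apply/cvgrPdist_le => e e0; have [d d0 Hd] := H _ e0.
    apply/nbhs_ballP; exists d => //= h.
    rewrite -ball_normE /= sub0r normrN => hd h0.
    rewrite -(ler_pM2l (_ : 0 < `|h|)) ?normr_gt0 //.
    rewrite -normrZ scalerBr scalerA divff // scale1r distrC mulrC.
    by rewrite [h *: v + a]addrC; exact: Hd.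
  by apply: DeriveDef; [exact: (cvgP _ cv) | exact: (cvg_lim _ cv)].
have /cvgrPdist_le /(_ _ e0) : h^-1 *: ((f \o shift a) (h *: v) - f a)
    @[h --> (0 : R)^'] --> df by rewrite -df2.
move=> /nbhs_ballP[d d0 Hd]; exists d => // h hd.
have [->|h0] := eqVneq h 0.
  by rewrite !scale0r addr0 !subrr !normr0 mulr0.
have := Hd h; rewrite -ball_normE /= sub0r normrN => /(_ hd h0).
rewrite -(ler_pM2l (_ : 0 < `|h|)) ?normr_gt0 //.
by rewrite -normrZ scalerBr scalerA divff // scale1r distrC mulrC [h *: v + a]addrC.
Qed.

End first_order.

Section real_line.
Context {R : realType}.
Local Notation mu := (@lebesgue_measure R).

(** Real induction: [Q] passes from a point just below the supremum of its truth set to a point just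
    above it, unless the supremum is 1, where the same step ends the proof. *)
Lemma continuous_induction01 (Q : R -> Prop) : Q 0 ->
  (forall t : R, 0 <= t <= 1 -> exists2 d, 0 < d & forall a b,
     0 <= a -> a <= t -> t <= b -> b <= 1 -> t - a < d -> b - t < d -> Q a -> Q b) ->
  Q 1.
Proof.
move=> Q0 step; pose T := [set t | 0 <= t <= 1 /\ Q t].
have T0 : T 0 by split => //; lra.
have supT : has_sup T by split; [exists 0 | exists 1 => t [/andP[]]].
have sup01 : 0 <= sup T <= 1.
  apply/andP; split; first by apply: ub_le_sup => //; case: supT.
  by apply: ge_sup; [exists 0 | move=> t [/andP[]]].
have [d d0 Hd] := step _ sup01.
have [a [a01 Qa] da] := sup_adherent d0 supT.
have aT : a <= sup T by apply: ub_le_sup; [case: supT | split].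
have [s1|s1] := eqVneq (sup T) 1.
  by apply: (Hd a 1) => //; move: a01; lra.
pose b := Num.min 1 (sup T + d / 2).
have b1 : b <= 1 by rewrite ge_min lexx.
have b2 : b <= sup T + d / 2 by rewrite ge_min lexx orbT.
have bs : sup T < b by rewrite lt_min; apply/andP; split; [rewrite lt_neqAle s1; lra | lra].
have Qb : Q b by apply: (Hd a b) => //; move: a01; lra.
have : b <= sup T by apply: ub_le_sup; [case: supT | split => //; lra].
by rewrite leNgt bs.
Qed.

(** The image of Lebesgue measure under a translation has the right value on intervals, hence is
    Lebesgue measure by uniqueness. *)
Lemma lebesgue_negligible_shift (A : set R) (c : R) :
  mu.-negligible A -> mu.-negligible [set t | A (t + c)].
Proof.
pose sh : measurableTypeR R -> measurableTypeR R := fun t => t + c.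
have msh : measurable_fun setT sh.
  by apply: measurable_funD => //; exact: measurable_id.
move=> [B [mB B0 AB]]; exists (sh @^-1` B); split.
- by have := msh measurableT _ mB; rewrite setTI.
- rewrite -B0; apply/esym.
  have := @lebesgue_measure_unique R (pushforward mu sh).
  move=> /(_ msh); apply=> // _ [[a b] _ <-]; rewrite /pushforward.
  rewrite [X in _ = mu X](_ : _ = `]a - c, b - c]%classic); last first.
    by apply/seteqP; split => t /=; rewrite !in_itv /= ltrBlDr lerBrDr.
  rewrite !lebesgue_measure_itv /= !lte_fin ltrD2r; case: ifP => // _.
  by rewrite -!EFinD; congr EFin; ring.
- by move=> t /AB.
Qed.

(** A hole of radius [c * r] centred within [r] of [t] lies in the ball of radius [(1 + c) * r]
    around [t], so [C] fills at most the proportion [1 / (1 + c)] of that ball. At arbitrarily small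
    scales this contradicts density 1 at [t], which holds for almost every [t] in [C]. *)
Lemma porosity_negligible (C : set R) (c : R) : closed C -> 0 < c ->
  mu.-negligible [set t | C t /\ forall d, 0 < d -> exists r h : R,
    [/\ 0 < r, r < d, `|h| <= r & forall s, `|s - (t + h)| < c * r -> ~ C s]].
Proof.
move=> Ccl c0; have mC : measurable (C : set (measurableTypeR R)) := closed_measurable Ccl.
have := lebesgue_density mC.
apply: negligibleS => t [Ct porous] /=.
rewrite indicE mem_set // => dens.
pose q : R := (1 + c)^-1.
have c1 : 0 < 1 + c by lra.
have q1 : q < 1 by rewrite invf_lt1 //; lra.
have : \forall r \near (0 : R)^'+, (q%:E < mu (C `&` ball t r) * (mu (ball t r))^-1)%E.
  apply: (dens [set y | (q%:E < y)%E]). by apply: open_ereal_gt'; rewrite lte_fin.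
move=> /nbhs_ballP[d /= d0 Hd].
(* The scale is divided by [1 + c] so that the enlarged radius [(1 + c) * r] stays below [d]. *)
have [r [h [r0 rd hr hole]]] := porous (d / (1 + c)) (divr_gt0 d0 c1).
have cr1 : 0 < (1 + c) * r by rewrite mulr_gt0.
have := Hd ((1 + c) * r).
rewrite -ball_normE /= sub0r normrN gtr0_norm // => /(_ _ cr1).
rewrite mulrC -ltr_pdivlMr // => /(_ rd); apply/negP; rewrite -leNgt mulrC.
have cr : 0 < c * r by rewrite mulr_gt0.
rewrite lebesgue_measure_ball ?(ltW cr1) // inver gt_eqF ?mulrn_wgt0 //.
have sumle : (mu (C `&` ball t ((1 + c) * r)%R) +
    mu (ball ((t : R) + h)%R (c * r)%R) <= mu (ball t ((1 + c) * r)%R))%E.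
  rewrite -measureU //=; last 3 first.
  - by apply: measurableI => //; exact: measurable_ball.
  - exact: measurable_ball.
  - apply/seteqP; split => // s [[Cs _]]; rewrite /ball /= distrC => /hole; exact.
  apply: le_measure; rewrite ?inE.
  - by apply: measurableU; [apply: measurableI => //|]; exact: measurable_ball.
  - exact: measurable_ball.
  - move=> s [[]//|]; rewrite /ball /= => hs.
    have -> : t - s = (t + h - s) - h by ring.
    by apply: (le_lt_trans (ler_normB _ _)); lra.
move: sumle; rewrite !lebesgue_measure_ball ?(ltW cr1) ?(ltW cr) //.
case: (mu (C `&` _)) => [x| |] //=; last first.
  by move=> _; rewrite gt0_mulNye ?leNye // lte_fin invr_gt0 mulrn_wgt0.
rewrite -EFinM -EFinD !lee_fin => sumle.
rewrite ler_pdivrMr ?mulrn_wgt0 // -mulr_natr.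
have -> : q * ((1 + c) * r * 2) = r * 2 by rewrite /q; field; lra.
by move: sumle; clear; lra.
Qed.

(** Real induction on the right end point: the larger of the constants on two adjacent intervals is
    valid on their union, by splitting an increment at the common point. *)
Lemma locally_lipschitz01 (V : normedModType R) (g : R -> V) :
  (forall t : R, exists L d : R, 0 < d /\ forall a b, `|a - t| < d -> `|b - t| < d ->
     `|g b - g a| <= L * `|b - a|) ->
  exists2 L, 0 <= L & forall a b, 0 <= a -> a <= b -> b <= 1 -> `|g b - g a| <= L * (b - a).
Proof.
move=> gL.
pose Q t := exists2 L, 0 <= L & forall a b, 0 <= a -> a <= b -> b <= t -> `|g b - g a| <= L * (b - a).
apply: (continuous_induction01 (Q := Q)) => [|t _].
  exists 0 => // a b a0 ab b0.
  have -> : a = b by lra.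
  by rewrite subrr normr0 mul0r.
have [L [d [d0 Hd]]] := gL t; exists d => // s u s0 st tu u1 sd ud [K K0 HK].
have Hd' a b : s <= a -> a <= b -> b <= u -> `|g b - g a| <= Num.max K L * (b - a).
  move=> sa ab bu.
  have := Hd a b; rewrite ![`|_ - t| < d]ltr_norml => /(_ _ _)/wrap[]; [lra|lra|].
  rewrite (@ger0_norm _ (b - a)) ?subr_ge0 // => /le_trans; apply.
  by rewrite ler_wpM2r ?subr_ge0 // le_max lexx orbT.
have HK' a b : 0 <= a -> a <= b -> b <= s -> `|g b - g a| <= Num.max K L * (b - a).
  move=> a0 ab bs; apply: (le_trans (HK a b a0 ab bs)).
  by rewrite ler_wpM2r ?subr_ge0 // le_max lexx.
exists (Num.max K L); first by rewrite le_max K0.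
move=> a b a0 ab bu.
have [bs|sb] := leP b s; first exact: HK'.
have [sa|as_] := leP s a; first exact: Hd'.
rewrite -(subrKA (g s)); apply: (le_trans (ler_normD _ _)).
have := HK' a s a0 (ltW as_) (lexx _); have := Hd' s b (lexx _) (ltW sb) bu.
by rewrite -[b - a](subrKA s) mulrDr; lra.
Qed.

Lemma absolutely_continuous01_lipschitz n (g : R -> 'cV[R]_n) L :
  (forall a b, 0 <= a -> a <= b -> b <= 1 -> `|g b - g a| <= L * (b - a)) ->
  absolutely_continuous01 g.
Proof.
move=> gL e e0; pose M := `|L| + 1.
have M0 : 0 < M by rewrite ltr_wpDl.
exists (e / M); first exact: divr_gt0.
move=> N a b ab _; rewrite ltr_pdivlMr // => /le_lt_trans; apply.
rewrite mulr_suml; apply: ler_sum => i _; have [a0 [abi b1]] := ab i.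
apply: (le_trans (gL _ _ a0 abi b1)); rewrite mulrC ler_wpM2l ?subr_ge0 //.
by rewrite /M; have := ler_norm L; lra.
Qed.

(* The null set where [phi' <= c] fails is covered by an open [U] of small
   measure; the increments of [phi] over [U] are absorbed by those of
   [M * mu (U `&` ]0, s])]. *)
Lemma lipschitz_ae_derive_le (phi : R -> R) L c :
  (forall a b, 0 <= a -> a <= b -> b <= 1 -> `|phi b - phi a| <= L * (b - a)) ->
  {ae mu, forall t : R, t \in `[0, 1] -> exists2 D, is_derive t 1 phi D & D <= c} ->
  phi 1 - phi 0 <= c.
Proof.
move=> phiL [N [mN N0 badN]].
pose M := `|L| + `|c|.
have M0 : 0 <= M by rewrite addr_ge0.
(* The error has two sources: [e] from the slope [c + e] over the unit interval, and [M * e] from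
   the measure of [U]. *)
suff key e : 0 < e -> phi 1 - phi 0 <= c + e * (1 + M).
  have M1 : 0 < 1 + M by rewrite ltr_pwDl.
  apply/ler_addgt0Pr => e e0; rewrite -[e](divfK (lt0r_neq0 M1)).
  exact: (key _ (divr_gt0 e0 M1)).
move=> e0.
have Noo : (mu N < +oo)%E by rewrite N0 ltry.
have [U [oU NU Ue]] := lebesgue_regularity_outer mN Noo e0.
have mU : measurable (U : set (measurableTypeR R)) := open_measurable oU.
have {}Ue : (mu U < e%:E)%E.
  suff -> : mu U = mu (U `\` N) by [].
  rewrite -[in LHS](setDUK NU) measureU ?setDIK //; last exact: measurableD.
  by rewrite [X in (X + _)%E]N0 add0e.
pose I a b : set (measurableTypeR R) := U `&` `]a, b]%classic.
have mI a b : measurable (I a b) by exact: measurableI.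
have Ifin a b : mu (I a b) \is a fin_num.
  rewrite ge0_fin_numE //; apply: (@le_lt_trans _ _ (mu U)).
    by apply: le_measure; rewrite ?inE //; exact: subIsetl.
  exact: lt_trans Ue (ltry _).
pose u s := fine (mu (I 0 s)).
have uD a b : 0 <= a -> a <= b -> u b = u a + fine (mu (I a b)).
  move=> a0 ab; rewrite /u -fineD // -measureU //.
    congr (fine (mu _)); rewrite /I -setIUr; congr (_ `&` _).
    by apply/seteqP; split => s /=; rewrite !in_itv /=; [case: (leP s a) => ?; [left|right]; lra | case; lra].
  by apply/seteqP; split => // s [[_ /=]] + [_ /=]; rewrite !in_itv /=; lra.
(* Here [u s] is the measure of the part of [U] in []0, s]]. Inside [U] the term [M * u] makes up
   for the growth of [phi], as [M >= L - c]; at a point outside [U] the derivative of [phi] is at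
   most [c], and the slack [e] absorbs the first-order error. *)
pose psi s := (c + e) * s + M * u s - phi s.
have u0 : u 0 = 0.
  rewrite /u /I (_ : `]0, 0]%classic = set0) ?setI0 ?measure0 //.
  by apply/seteqP; split => // s /=; rewrite in_itv /=; lra.
have u1 : u 1 <= e.
  rewrite -[leRHS]/(fine e%:E) fine_le // ltW // (le_lt_trans _ Ue) //.
  by apply: le_measure; rewrite ?inE //; exact: subIsetl.
suff : psi 0 <= psi 1.
  rewrite /psi u0 !mulr0 !mulr1 add0r sub0r => H.
  by have := ler_wpM2l M0 u1; lra.
have incr a b : 0 <= a -> a <= b -> `]a, b]%classic `<=` U -> b <= 1 -> psi a <= psi b.
  move=> a0 ab abU b1; rewrite /psi (uD _ _ a0 ab).
  have -> : I a b = `]a, b]%classic by rewrite /I setIidr.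
  rewrite lebesgue_measure_itv /= lte_fin.
  set x := fine _; have -> : x = b - a by rewrite /x; case: ltP => //= ba; lra.
  have := phiL _ _ a0 ab b1; rewrite ler_norml => /andP[_].
  have /(ler_wpM2r (_ : 0 <= b - a)) := ler_norm L; rewrite subr_ge0 => /(_ ab).
  have /(ler_wpM2r (_ : 0 <= b - a)) : - c <= `|c| by rewrite -normrN ler_norm.
  rewrite subr_ge0 => /(_ ab); rewrite /M; set z := `|L|; set y := `|c|.
  have := mulr_ge0 (ltW e0) (_ : 0 <= b - a); rewrite subr_ge0 => /(_ ab).
  by move=> *; nra.
apply: (continuous_induction01 (Q := fun s => psi 0 <= psi s)) => // t t01.
have [Ut|nUt] := pselect (U t).
  have /nbhs_ballP[d /= d0 dU] : nbhs t U by exact: open_nbhs_nbhs.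
  exists d => // a b a0 at_ tb b1 ad bd /le_trans; apply.
  apply: incr => //; [lra|].
  move=> s /=; rewrite in_itv /= => sab; apply: dU.
  by rewrite -ball_normE /= ltr_norml; lra.
have [D /is_derive_approxP /(_ _ e0)[d d0 Hd] Dc] : exists2 D, is_derive t 1 phi D & D <= c.
  have : ~ N t by move=> /NU.
  by move=> /(contra_notP (badN t)); apply; rewrite /= in_itv /=; exact: t01.
exists d => // a b a0 at_ tb b1 ad bd /le_trans; apply.
have uge x y : 0 <= fine (mu (I x y)) by exact: fine_ge0.
have /andP[t0 t1] := t01.
rewrite /psi (uD a b) //; last by lra.
have Mu := mulr_ge0 M0 (uge a b).
have := Hd (a - t); have := Hd (b - t).
rewrite !ltr_norml !scaler1 ![t + _]addrC !subrK => /(_ _)/wrap[]; first by lra.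
move=> Hb /(_ _)/wrap[]; first by lra.
move: Hb; rewrite (@ger0_norm _ (b - t)) ?(@ler0_norm _ (a - t)); [|lra|lra].
rewrite !ler_norml /GRing.scale /= => /andP[_ Hb] /andP[Ha _].
have := ler_wpM2r (_ : 0 <= b - a) Dc; rewrite subr_ge0 => /(_ (le_trans at_ tb)).
by rewrite mulrDr; lra.
Qed.
End real_line.

(** * Null sets of columns *)

Section lebesgue_tuple_measure.
Context {R : realType}.
Local Notation T n := (n.-tuple (measurableTypeR R)).
Local Notation mu := (@lebesgue_measure R).

Lemma pushforward_sigma_finite d d' (X : measurableType d) (Y : measurableType d')
    (nu : {measure set X -> \bar R}) (f : X -> Y) (g : Y -> X)
    (mf : measurable_fun setT f) :
  sigma_finite setT nu -> measurable_fun setT g -> cancel f g ->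
  exists nu' : {sigma_finite_measure set Y -> \bar R},
    nu' = pushforward nu f :> (set Y -> \bar R).
Proof.
move=> [F FT Foo] mg fK.
pose m : {measure set Y -> \bar R} :=
  measure_function_pushforward__canonical__measure_function_Measure nu mf.
have sf : sigma_finite setT m.
  exists (fun k => g @^-1` F k).
    by rewrite -preimage_bigcup -FT preimage_setT.
  move=> k; have [mF mFoo] := Foo k; split.
    by have := mg measurableT _ mF; rewrite setTI.
  rewrite /m /= /pushforward -comp_preimage.
  by rewrite (_ : g \o f = id) //; apply/funext => x; exact: fK.
pose B := Measure_isSigmaFinite.Build _ Y R m sf.
pose M : {sigma_finite_measure set Y -> \bar R} := HB.pack (Measure.sort m) (Measure.class m) B.
by exists M.
Qed.

Lemma product_sigma_finite d d' (X : measurableType d) (Y : measurableType d')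
    (m1 : {sigma_finite_measure set X -> \bar R})
    (m2 : {sigma_finite_measure set Y -> \bar R}) :
  sigma_finite setT (m1 \x m2)%E.
Proof.
have /sigma_finiteP[F [TF ndF Foo]] := sigma_finiteT m1.
have /sigma_finiteP[G [TG ndG Goo]] := sigma_finiteT m2.
exists (fun n => F n `*` G n).
  apply/seteqP; split => // -[x y] _.
  have [k _ Fx] : (\bigcup_k F k) x by rewrite -TF.
  have [l _ Gy] : (\bigcup_k G k) y by rewrite -TG.
  exists (maxn k l) => //; split => /=.
    by move: x Fx; exact/subsetPset/ndF/leq_maxl.
  by move: y Gy; exact/subsetPset/ndG/leq_maxr.
move=> k; have [mF Fk] := Foo k; have [mG Gk] := Goo k; split.
  exact: measurableX.
by rewrite product_measure1E // lte_mul_pinfty // ge0_fin_numE.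
Qed.

Lemma measurable_cons_tuple n :
  measurable_fun setT (fun z : measurableTypeR R * T n => [tuple of z.1 :: z.2] : T n.+1).
Proof. exact: (@measurable_cons _ _ _ _ fst n snd). Qed.

(** [lebesgue_tuple] is a bare set function; the bundled measure with the same values gives access
    to countable unions and Fubini. *)
Lemma lebesgue_tuple_sigma_finite n :
  exists nu : {sigma_finite_measure set (T n) -> \bar R},
    nu = @lebesgue_tuple R n :> (set (T n) -> \bar R).
Proof.
elim: n => [|n [nu nuE]]; first by exists (dirac [tuple]).
pose g (t : T n.+1) : measurableTypeR R * T n := (thead t, [tuple of behead t]).
have mg : measurable_fun setT g.
  apply/measurable_fun_pairP; split; first exact: measurable_tnth.
  exact: measurable_behead.
have := pushforward_sigma_finite (@measurable_cons_tuple n)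
  (product_sigma_finite mu nu) mg.
case=> [[a t]|nu' nu'E]; last by exists nu'; rewrite nu'E /= -nuE.
by rewrite /g /= theadE; congr pair; apply/val_inj.
Qed.

Lemma lebesgue_tuple_bigcup n (I : countType) (F : I -> set (T n)) :
  (forall i, (@lebesgue_tuple R n).-negligible (F i)) ->
  (@lebesgue_tuple R n).-negligible (\bigcup_i F i).
Proof.
have [nu <-] := lebesgue_tuple_sigma_finite n => nF.
pose G k := if unpickle k is Some i then F i else set0.
apply: (@negligibleS _ _ _ nu (\bigcup_k G k)) => [x [i _ Fx]|].
  by exists (pickle i) => //; rewrite /G pickleK.
apply: negligible_bigcup => k; rewrite /G; case: unpickle => // ; exact: negligible_set0.
Qed.

Definition upd n (t : T n) (j : 'I_n) (s : R) : T n :=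
  [tuple if i == j then s else tnth t i | i < n].

(** Both orders of integration agree on rectangles, hence everywhere by uniqueness of the product
    measure. This lets either factor be integrated first. *)
Lemma product_measure12 d d' (X : measurableType d) (Y : measurableType d')
    (m1 : {sigma_finite_measure set X -> \bar R})
    (m2 : {sigma_finite_measure set Y -> \bar R}) A : measurable A ->
  (m1 \x m2)%E A = (m1 \x^ m2)%E A.
Proof.
move=> mA; pose m' : {measure set (X * Y) -> \bar R} := (m1 \x^ m2)%E.
by apply: (product_measure_unique (m' := m')) => // B C mB mC; exact: product_measure2E.
Qed.

(** Fubini, by induction on [n]. If [j] is the head coordinate, the inner integral is taken over the
    head and vanishes; otherwise the head is frozen and the induction hypothesis applies to the
    slice. *)
Lemma lebesgue_tuple_null_lines n (j : 'I_n) (N : set (T n)) : measurable N ->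
  (forall t, mu.-negligible [set s | N (upd t j s)]) -> lebesgue_tuple N = 0%E.
Proof.
elim: n j N => [[]//|n IH] j N mN Nj.
have [nu nuE] := lebesgue_tuple_sigma_finite n.
pose cns (z : measurableTypeR R * T n) : T n.+1 := [tuple of z.1 :: z.2].
have mcN : measurable (cns @^-1` N).
  by have := @measurable_cons_tuple n measurableT _ mN; rewrite setTI.
rewrite /= /pushforward -/cns -nuE.
case: (unliftP ord0 j) => [j'|] jE; last first.
  rewrite product_measure12 // /product_measure2 integral0_eq // => t _ /=.
  apply: measure_negligible; first exact: measurable_ysection.
  apply: negligibleS (Nj [tuple of 0 :: t]) => s; rewrite /ysection /= inE.
  rewrite jE; congr (N _); apply: eq_from_tnth => i; rewrite tnth_mktuple.
  by case: (unliftP ord0 i) => [i'|] ->; rewrite ?tnthS.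
rewrite /product_measure1 integral0_eq // => a _ /=.
rewrite nuE; apply: (IH j'); first exact: measurable_xsection.
move=> t; apply: negligibleS (Nj [tuple of a :: t]) => s; rewrite /xsection /= inE.
rewrite jE; congr (N _); apply: eq_from_tnth => i; rewrite tnth_mktuple.
case: (unliftP ord0 i) => [i'|] -> //.
by rewrite !tnthS tnth_mktuple (inj_eq lift_inj).
Qed.

End lebesgue_tuple_measure.

(** * Measurable and null sets of columns, and the test along parallel lines *)

Section columns.
Context {R : realType} (n : nat).
Local Notation mu := (@lebesgue_measure R).
Implicit Type S : set 'cV[R]_n.

Definition measurable_cols S :=
  measurable ((@col_of_tuple R n : n.-tuple (measurableTypeR R) -> _) @^-1` S).

Definition null_cols S :=
  (@lebesgue_tuple R n).-negligible (@col_of_tuple R n @^-1` S).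

(** An open set is the union of the countably many balls with rational centre and radius
    [1 / (k + 1)] that it contains. A ball of the max norm is a finite intersection of coordinate
    conditions, hence measurable. *)
Lemma open_measurable_cols S : open S -> measurable_cols S.
Proof.
move=> oS.
pose B (c : 'cV[rat]_n * nat) := ball (map_mx ratr c.1 : 'cV[R]_n) c.2.+1%:R^-1.
have SE : S = \bigcup_(c in [set c | B c `<=` S]) B c.
  apply/seteqP; split => [x Sx|x [c]]; last exact.
  have /nbhs_ballP[e /= e0 eS] : nbhs x S by exact: open_nbhs_nbhs.
  have [k ke] : exists k, k.+1%:R^-1 < e / 2.
    have e2 : 0 < e / 2 by rewrite divr_gt0.
    have [k _ Hk] := near_infty_natSinv_lt (PosNum e2).
    by exists k; exact: Hk (leqnn k).
  pose k0 : R := k.+1%:R^-1.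
  have k00 : 0 < k0 by rewrite invr_gt0.
  have /fin_all_exists[q Hq] : forall i : 'I_n, exists q : rat, `|x i 0 - ratr q| < k0.
    move=> i; have := @rat_in_itvoo R (x i 0 - k0) (x i 0 + k0).
    case; first by lra.
    by move=> q; rewrite in_itv /= => qx; exists q; rewrite ltr_norml; lra.
  have xc : B (\col_i q i, k) x.
    rewrite /B /= -ball_normE /= distrC.
    rewrite /Num.norm /= mx_normrE; apply: bigmax_lt => // -[i j] _ /=.
    by rewrite (ord1 j) !mxE.
  exists (\col_i q i, k) => //= y; rewrite /B -!ball_normE /= in xc * => yc.
  apply: eS; rewrite -ball_normE /=; rewrite distrC in xc.
  rewrite -(subrKA (map_mx ratr (\col_i q i))); apply: (le_lt_trans (ler_normD _ _)).
  by rewrite -/k0 in ke yc xc; lra.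
rewrite /measurable_cols SE preimage_bigcup.
rewrite bigcup_mkcond; apply: countable_bigcupT_measurable => // c.
case: ifP => // _.
rewrite (_ : _ @^-1` _ = \bigcap_(i in [set: 'I_n])
    ((fun t => tnth t i) @^-1` ball (ratr (c.1 i 0) : R) c.2.+1%:R^-1)).
  apply: fin_bigcap_measurable => // i _.
  have := @measurable_tnth _ (measurableTypeR R) n i measurableT _
    (measurable_ball (ratr (c.1 i 0) : R) c.2.+1%:R^-1).
  by rewrite setTI.
apply/seteqP; split => t /=.
  rewrite /B -!ball_normE /= => H i _ /=.
  apply: le_lt_trans H.
  by have := mx_entry_le_norm (map_mx ratr c.1 - col_of_tuple t) i 0; rewrite !mxE.
move=> H; rewrite /B -ball_normE /= /Num.norm /= mx_normrE.
apply: bigmax_lt => [|[i j] _ /=]; first by rewrite invr_gt0.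
by rewrite (ord1 j) !mxE; have := H i I; rewrite /= -ball_normE.
Qed.

Lemma closed_measurable_cols S : closed S -> measurable_cols S.
Proof.
rewrite -openC => /open_measurable_cols; rewrite /measurable_cols.
by rewrite preimage_setC => /measurableC; rewrite setCK.
Qed.

Lemma null_colsS S1 S2 : S1 `<=` S2 -> null_cols S2 -> null_cols S1.
Proof. by move=> S12 [A [mA A0 S2A]]; exists A; split => // t /S12 /S2A. Qed.

Lemma null_cols_bigcup (I : countType) (F : I -> set 'cV[R]_n) :
  (forall i, null_cols (F i)) -> null_cols (\bigcup_i F i).
Proof. by move=> nF; rewrite /null_cols preimage_bigcup; exact: lebesgue_tuple_bigcup. Qed.

Lemma null_colsU S1 S2 : null_cols S1 -> null_cols S2 -> null_cols (S1 `|` S2).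
Proof.
move=> n1 n2; have : null_cols (\bigcup_(b : bool) if b then S1 else S2).
  by apply: null_cols_bigcup => -[].
by apply: null_colsS => x [Sx|Sx]; [exists true|exists false].
Qed.

Lemma null_cols_lines (j : 'I_n) S : measurable_cols S ->
  (forall x, mu.-negligible [set s | S (x + s *: delta_mx j 0)]) -> null_cols S.
Proof.
move=> mS Sj; exists (@col_of_tuple R n @^-1` S); split => //.
apply: (lebesgue_tuple_null_lines mS (j := j)) => t.
(* The base point is [t] with its [j]-th coordinate set to 0, so that the parameter [s] of the line
   is the new coordinate itself. *)
apply: negligibleS (Sj (col_of_tuple t - tnth t j *: delta_mx j 0)) => s /=.
congr (S _); apply/matrixP => i k; rewrite (ord1 k) !mxE tnth_mktuple eqxx andbT.
by case: eqP => [->|]; rewrite ?mulr1 ?mulr0 ?subr0 ?addr0 // subrr add0r.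
Qed.

End columns.

(** * Locally Lipschitz maps *)

Section local_lipschitz.
Context {R : realType}.

Lemma exists_natSinv_lt (e : R) : 0 < e -> exists k : nat, k.+1%:R^-1 < e.
Proof.
move=> e0; have [k _ Hk] := near_infty_natSinv_lt (PosNum e0).
by exists k; exact: Hk (leqnn k).
Qed.

Lemma subl_continuous (V : normedModType R) (y : V) : continuous (fun x => y - x).
Proof. by move=> x; apply: cvgB; [exact: cvg_cst | exact: cvg_id]. Qed.

(** Replaces the neighbourhood and the filter of large constants in the definition by an explicit
    radius and an explicit nonnegative constant. *)
Lemma locally_lipschitzP m n (f : 'cV[R]_m -> 'cV[R]_n) :
  locally_lipschitz f <-> forall x, exists L d : R, [/\ 0 <= L, 0 < d &
    forall y z, `|y - x| < d -> `|z - x| < d -> `|f y - f z| <= L * `|y - z|].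
Proof.
split=> [fl x|fl x].
  have [U /nbhs_ballP[d /= d0 dU] Ulip] := fl x.
  have [L [L0 HL]] : exists L, 0 <= L /\ forall y z, U y -> U z -> `|f y - f z| <= L * `|y - z|.
    move: Ulip; rewrite /lipschitz_on => /pinfty_ex_gt0[L L0 HL].
    exists L; split; first exact: ltW.
    by move=> y z Uy Uz; have := HL (y, z) (conj Uy Uz).
  exists L, d; split => // y z yd zd; apply: HL; apply: dU;
    by rewrite -ball_normE /= distrC.
have [L [d [L0 d0 HL]]] := fl x.
exists (ball x d); first exact: nbhsx_ballx.
rewrite /lipschitz_on; near=> M; move=> [y z] [/= yd zd] /=.
rewrite -ball_normE /= in yd zd.
rewrite /self_sub /=.
apply: (@le_trans _ _ (L * `|y - z|)); first by apply: HL; rewrite distrC.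
by apply: ler_wpM2r => //; near: M; exact: nbhs_pinfty_ge.
Unshelve. all: by end_near. Qed.

Lemma locally_lipschitz_continuous m n (f : 'cV[R]_m -> 'cV[R]_n) :
  locally_lipschitz f -> continuous f.
Proof.
move=> /locally_lipschitzP fl x; have [L [d [L0 d0 HL]]] := fl x.
apply/(@cvgrPdist_le _ _ _ (nbhs x)) => e e0.
have d'0 : 0 < Num.min d (e / (L + 1)).
  by rewrite lt_min d0 divr_gt0 // ltr_wpDl.
apply/nbhs_ballP; exists (Num.min d (e / (L + 1))) => // y.
rewrite -ball_normE /= lt_min => /andP[yd ye].
have L1 : 0 < L + 1 by lra.
rewrite ltr_pdivlMr // in ye.
apply: (le_trans (HL x y _ _)); first by rewrite subrr normr0.
  by rewrite distrC.
by move: ye (normr_ge0 (x - y)); lra.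
Qed.

Lemma mulmx_continuous m n q (A : 'M[R]_(n, m)) : continuous (mulmx A : 'M[R]_(m, q) -> _).
Proof.
move=> x; apply/(@cvgrPdist_le _ _ _ (nbhs x)) => e e0.
pose K := m%:R * `|A| + 1.
have K0 : 0 < K by rewrite ltr_wpDl // mulr_ge0.
apply/nbhs_ballP; exists (e / K); first exact: divr_gt0.
move=> y; rewrite -ball_normE /= ltr_pdivlMr // => ye.
rewrite -mulmxBr; apply: (le_trans (mulmx_norm_le _ _)).
by rewrite mulrA; move: ye (normr_ge0 (x - y)); rewrite /K; lra.
Qed.

Lemma differentiable_approx (V W : normedModType R) (f : V -> W) x (L : {linear V -> W}) :
  continuous L -> (forall e, 0 < e -> exists2 d, 0 < d & forall w, `|w| < d ->
     `|f (x + w) - f x - L w| <= e * `|w|) ->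
  differentiable f x.
Proof.
move=> cL H; have o : f \o shift x = cst (f x) + L +o_ 0 id.
  apply/eqaddoP => e e0; have [d d0 Hd] := H _ e0.
  apply/nbhs_ballP; exists d => // w; rewrite -ball_normE /= sub0r normrN => wd.
  by rewrite /= !fctE opprD addrA [w + x]addrC; exact: Hd.
by apply/diff_locallyP; rewrite (diff_unique cL o).
Qed.

(** By completeness, derivability is a Cauchy condition on difference quotients. It names no limit,
    so the set where it fails can be written with countable operations on open sets. *)
Lemma derivable_cauchyP m n (f : 'cV[R]_m -> 'cV[R]_n) x v :
  (forall e, 0 < e -> exists2 d, 0 < d & forall h h' : R,
     0 < `|h| < d -> 0 < `|h'| < d ->
     `|h^-1 *: (f (x + h *: v) - f x) - h'^-1 *: (f (x + h' *: v) - f x)| <= e) <->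
  derivable f x v.
Proof.
split=> [H|/derivableP/is_derive_approxP H e e0]; last first.
  have e20 : 0 < e / 2 by rewrite divr_gt0.
  have [d d0 Hd] := H _ e20; exists d => // h h' /andP[h0 hd] /andP[h'0 h'd].
  have Hh a : 0 < `|a| -> `|a| < d ->
      `|a^-1 *: (f (x + a *: v) - f x) - 'D_v f x| <= e / 2.
    move=> a0 ad; rewrite -(ler_pM2l a0) -normrZ scalerBr scalerA divff -?normr_gt0 //.
    by rewrite scale1r mulrC; exact: Hd.
  rewrite -(subrKA ('D_v f x)); apply: (le_trans (ler_normD _ _)).
  have := Hh _ h0 hd; have := Hh _ h'0 h'd; rewrite distrC.
  lra.
rewrite /derivable; apply/cauchy_cvgP/cauchy_exP => e e0.
have e20 : 0 < e / 2 by rewrite divr_gt0.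
have [d d0 Hd] := H _ e20.
have d20 : 0 < d / 2 by rewrite divr_gt0.
exists ((d / 2)^-1 *: (f (x + (d / 2) *: v) - f x)).
apply/nbhs_ballP; exists d => // h; rewrite -ball_normE /= sub0r normrN => hd h0.
rewrite -ball_normE /= [h *: v + x]addrC; apply: (@le_lt_trans _ _ (e / 2)); last by lra.
by apply: Hd; rewrite ?normr_gt0 ?h0 //= gtr0_norm //; lra.
Qed.

Lemma line_locally_lipschitz m n (f : 'cV[R]_m -> 'cV[R]_n) x v : locally_lipschitz f ->
  forall t : R, exists L d : R, 0 < d /\ forall a b, `|a - t| < d -> `|b - t| < d ->
     `|f (x + b *: v) - f (x + a *: v)| <= L * `|b - a|.
Proof.
move=> /locally_lipschitzP fl t; have [L [d [L0 d0 HL]]] := fl (x + t *: v).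
have v1 : 0 < `|v| + 1 by rewrite ltr_wpDl.
exists (L * `|v|), (d / (`|v| + 1)); split; first exact: divr_gt0.
move=> a b ad bd; have lineB s u : x + s *: v - (x + u *: v) = (s - u) *: v.
  by rewrite scalerBl opprD addrACA subrr add0r.
have near s : `|s - t| < d / (`|v| + 1) -> `|x + s *: v - (x + t *: v)| < d.
  rewrite ltr_pdivlMr // lineB normrZ => /(le_lt_trans _); apply.
  by rewrite ler_wpM2l // lerDl.
by apply: (le_trans (HL _ _ (near _ bd) (near _ ad))); rewrite lineB normrZ -mulrA [`|v| * _]mulrC.
Qed.

Lemma is_derive_lineP m n (f : 'cV[R]_m -> 'cV[R]_n) x v (t : R) D :
  is_derive t 1 (fun s => f (x + s *: v)) D <-> is_derive (x + t *: v) v f D.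
Proof.
by split=> /is_derive_approxP H; apply/is_derive_approxP => e /H[d d0 Hd];
  exists d => // h hd; have := Hd h hd; rewrite scaler1 scalerDl addrA.
Qed.

Lemma line_absolutely_continuous m n (f : 'cV[R]_m -> 'cV[R]_n) x v :
  locally_lipschitz f -> absolutely_continuous01 (fun t => f (x + t *: v)).
Proof.
move=> /(line_locally_lipschitz x v)/(@locally_lipschitz01 _ _ (fun t => f (x + t *: v)))[L _].
exact: absolutely_continuous01_lipschitz.
Qed.

(** Curves live on [[0, 1]], lines on the whole of [R]: the integer translates of the unit interval
    cover [R] and there are countably many. *)
Lemma ae_unit_intervals (P : R -> Prop) :
  (forall k : int, {ae (@lebesgue_measure R), forall t : R, t \in `[0, 1] -> P (t + k%:~R)}) ->
  (@lebesgue_measure R).-negligible [set s | ~ P s].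
Proof.
move=> Pk.
pose F i := if @unpickle int i is Some k then
  [set s : R | ~ ((s - k%:~R) \in `[0, 1] -> P (s - k%:~R + k%:~R))] else set0.
apply: (@negligibleS _ _ _ (@lebesgue_measure R) (\bigcup_i F i)).
  move=> s nP; exists (pickle (Num.floor s)) => //; rewrite /F pickleK /= subrK => H.
  apply: nP; apply: H; rewrite in_itv /=.
  by have := Num.Theory.floor_itv s; rewrite intrD; lra.
apply: negligible_bigcup => i; rewrite /F; case: unpickle => [k|]; last exact: negligible_set0.
have := lebesgue_negligible_shift (- k%:~R) (Pk k).
by apply: negligibleS => s; apply: contra_not.
Qed.

End local_lipschitz.

(** * Rademacher's theorem *)

Section rademacher.
Context {R : realType} (m n : nat) (f : 'cV[R]_m -> 'cV[R]_n).
Hypothesis fl : locally_lipschitz f.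
Hypothesis ae_derivable_curve : forall g : R -> 'cV[R]_n, absolutely_continuous01 g ->
  {ae (@lebesgue_measure R), forall t : R, t \in `[0, 1] -> derivable g t 1}.
Local Notation mu := (@lebesgue_measure R).
Local Notation e_ j := (delta_mx j 0 : 'cV[R]_m).
Let fc : continuous f := locally_lipschitz_continuous fl.

Definition error (A : 'M[R]_(n, m)) (w x : 'cV[R]_m) := `|f (x + w) - f x - A *m w|.

Lemma error_continuous A w : continuous (error A w).
Proof.
move=> x; apply: continuous_comp; last exact: norm_continuous.
apply: continuousB; last exact: cst_continuous.
apply: continuousB; last exact: fc.
have sh : y + w @[y --> x] --> x + w by exact: (cvgD cvg_id (cvg_cst w)).
exact: (cvg_comp _ _ sh (@fc _)).
Qed.

Definition supported (S : {set 'I_m}) (w : 'cV[R]_m) :=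
  forall j, j \notin S -> w j 0 = 0.

(** Only displacements along [S] are tested, so the columns of [A] outside [S] are unconstrained. *)
Definition differentiable_on (S : {set 'I_m}) (x : 'cV[R]_m) (A : 'M[R]_(n, m)) :=
  forall e, 0 < e -> exists2 d, 0 < d & forall w, supported S w -> `|w| < d ->
    error A w x <= e * `|w|.

(* The fixed scale [1 / (k + 1)] makes [good] closed; countably many of these
   sets, with [A] rational, cover the points of differentiability along [S]. *)
Definition good S A e k : set 'cV[R]_m := [set x |
  (forall y z, `|y - x| < k.+1%:R^-1 -> `|z - x| < k.+1%:R^-1 -> `|f y - f z| <= k%:R * `|y - z|) /\
  forall w, supported S w -> `|w| < k.+1%:R^-1 -> error A w x <= e * `|w|].

(** The bound is violated at arbitrarily small displacements. For each scale the union over all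
    displacements is open, so [bad] is a countable intersection of open sets. *)
Definition bad S A e : set 'cV[R]_m := \bigcap_k \bigcup_(w in
  [set w | supported S w /\ `|w| < k.+1%:R^-1]) [set x | e * `|w| < error A w x].

(** The Lipschitz condition has strict inequalities as premises, so its contrapositive is closed:
    for each pair violating the bound, one of the two points is at distance at least [1 / (k + 1)]
    from [x]. *)
Lemma good_closed S A e k : closed (good S A e k).
Proof.
have -> : good S A e k =
    (\bigcap_(p in [set p : 'cV[R]_m * 'cV[R]_m | ~ `|f p.1 - f p.2| <= k%:R * `|p.1 - p.2|])
      ([set x | k.+1%:R^-1 <= `|p.1 - x|] `|` [set x | k.+1%:R^-1 <= `|p.2 - x|])) `&`
    \bigcap_(w in [set w | supported S w /\ `|w| < k.+1%:R^-1]) [set x | error A w x <= e * `|w|].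
  apply/seteqP; split => x [lx dx]; split.
  - move=> [y z] /= nyz; have [yx|] := ltP `|y - x| k.+1%:R^-1; last by left.
    by have [zx|] := ltP `|z - x| k.+1%:R^-1; [case: nyz; exact: lx | right].
  - by move=> w [] /=; exact: dx.
  - move=> y z yx zx; apply: contrapT => nyz.
    by have [] := lx (y, z) nyz => /=; rewrite leNgt ?yx ?zx.
  - by move=> w Sw wk; exact: (dx w (conj Sw wk)).
have dist_closed y : closed [set x : 'cV[R]_m | k.+1%:R^-1 <= `|y - x|].
  rewrite (_ : [set x | _] = (fun x => `|y - x|) @^-1` [set r | k.+1%:R^-1 <= r]) //.
  apply: closed_comp; last exact: closed_ge.
  by move=> x _; exact: (cvg_norm (@subl_continuous _ _ y x)).
apply: closedI; apply: closed_bigI => //.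
  by move=> p _; apply: closedU; exact: dist_closed.
move=> w _; rewrite (_ : [set x | _] = error A w @^-1` [set r | r <= e * `|w|]) //.
by apply: closed_comp; [move=> x _; exact: error_continuous | exact: closed_le].
Qed.

Lemma bad_measurable S A e : measurable_cols (bad S A e).
Proof.
rewrite /measurable_cols preimage_bigcap; apply: bigcap_measurable => [|k _]; first by exists 0%N.
apply: open_measurable_cols; apply: bigcup_open => w _.
rewrite (_ : [set x | _] = error A w @^-1` [set r | e * `|w| < r]) //.
by apply: open_comp; [move=> x _; exact: error_continuous | exact: open_gt].
Qed.

(* Let [x] be good and bad, with [w] violating the bound at [x] and [h] its
   [j]-th coordinate. A good point close to [x + h e_j] would transport the
   estimate along [S] there and bound the error of [w]; hence the good set has
   a hole around [x + h e_j] of radius proportional to [|w|], and is porous at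
   [x] on the line through [x] of direction [e_j]. *)
Lemma good_bad_null S j A e k : 0 < e ->
  null_cols (good S A e k `&` good [set j] A e k `&` bad (j |: S) A (4 * e)).
Proof.
move=> e0; apply: (null_cols_lines (j := j)).
  apply: measurableI; last exact: bad_measurable.
  by apply: measurableI; apply: closed_measurable_cols; exact: good_closed.
move=> x0; pose line (s : R) := x0 + s *: e_ j.
have line_cont : continuous line.
  by move=> s; exact: (cvgD (cvg_cst x0) (@scalel_continuous _ _ (e_ j) s)).
pose C := line @^-1` good S A e k.
have Ccl : closed C.
  by apply: closed_comp; [move=> s _; exact: line_cont | exact: good_closed].
(* The ratio of the hole: [k * c <= e] lets the Lipschitz constant [k] turn a displacement of size
   [c * |w|] into an error [e * |w|]. *)
pose c := Num.min 1 (e / (k%:R + 1)).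
have k1 : 0 < k%:R + 1 :> R by rewrite ltr_wpDl.
have c0 : 0 < c by rewrite lt_min ltr01 divr_gt0.
have c1 : c <= 1 by rewrite ge_min lexx.
have ce : k%:R * c <= e.
  apply: (@le_trans _ _ (k%:R * (e / (k%:R + 1)))).
    by rewrite ler_wpM2l // ge_min lexx orbT.
  by rewrite mulrA ler_pdivrMr // mulrC ler_wpM2l ?lerDl ?ltW.
apply: negligibleS (porosity_negligible Ccl c0) => s [[xS xj] xbad]; split => // d d0.
set x := x0 + s *: e_ j in xS xj xbad.
have k0 : 0 < k.+1%:R^-1 :> R by rewrite invr_gt0.
(* [w] must be smaller than the porosity scale [d], and [3 * |w|] smaller than [1 / (k + 1)],
   because every point used below is within [3 * |w|] of [x]. *)
have [l ld] : exists l : nat, l.+1%:R^-1 < Num.min d (k.+1%:R^-1 / 3).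
  by apply: exists_natSinv_lt; rewrite lt_min d0 divr_gt0.
have [w [Sw wl] /= xw] := xbad l I.
have {ld} : `|w| < Num.min d (k.+1%:R^-1 / 3) := lt_trans wl ld.
rewrite lt_min => /andP[wd wk].
have wk3 : 3 * `|w| < k.+1%:R^-1 by rewrite mulrC -ltr_pdivlMr.
have w0 : 0 < `|w|.
  rewrite normr_gt0; apply/eqP => w0; move: xw.
  by rewrite /error w0 normr0 mulr0 mulmx0 addr0 !subrr normr0 ltxx.
exists `|w|, (w j 0); split => //; first exact: mx_entry_le_norm.
move=> s' s'h [lip' bound']; move: xw; apply/negP; rewrite -leNgt.
set x' := line s' in lip' bound'.
set h := w j 0 in s'h.
pose w' := w - h *: e_ j.
have w'E i : w' i 0 = if i == j then 0 else w i 0.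
  by rewrite !mxE eqxx andbT; case: eqP => [->|]; rewrite ?mulr1 ?subrr // mulr0 subr0.
have w'w : `|w'| <= `|w|.
  apply: mx_norm_le => // i z; rewrite (ord1 z) w'E.
  by case: ifP => _; [rewrite normr0 | exact: mx_entry_le_norm].
have hw : `|h| <= `|w| := mx_entry_le_norm w j 0.
have ej1 : `|e_ j| <= 1.
  apply: mx_norm_le => // i z; rewrite mxE.
  by case: (_ && _); rewrite ?normr1 ?normr0.
have he a : `|a *: e_ j| <= `|a| by rewrite normrZ ler_piMr.
have Sw' : supported S w'.
  move=> i iS; rewrite w'E; case: eqP => // /eqP ij; apply: Sw.
  by rewrite in_setU1 negb_or ij.
have jh : supported [set j] (h *: e_ j).
  by move=> i; rewrite finset.in_set1 !mxE => /negbTE ->; rewrite mulr0.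
have x'E : x' = x + (s' - s) *: e_ j.
  by rewrite /x' /line /x scalerBl addrCA addrC addrK.
have x'h : `|x' - (x + h *: e_ j)| <= c * `|w|.
  rewrite x'E opprD addrACA subrr add0r -scalerBl; apply: le_trans (he _) _.
  by rewrite -addrA -opprD; exact: ltW.
have cw : c * `|w| <= `|w| by rewrite ler_piMl.
have xK u : x + u - x = u by rewrite addrAC subrr add0r.
have x'x : `|x' - x| <= 2 * `|w|.
  rewrite -(subrKA (x + h *: e_ j)); apply: (le_trans (ler_normD _ _)).
  by rewrite xK; have := he h; lra.
have lip y z : `|y - x| <= 3 * `|w| -> `|z - x| <= 3 * `|w| -> `|f y - f z| <= k%:R * `|y - z|.
  by move=> yx zx; apply: xS.1; exact: le_lt_trans wk3.
have B1 : error A (h *: e_ j) x <= e * `|w|.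
  apply: (le_trans (xj.2 _ jh _)); first by apply: le_lt_trans wk3; have := he h; lra.
  by rewrite ler_wpM2l ?(ltW e0) //; have := he h; lra.
have B2 : error A w' x' <= e * `|w|.
  apply: (le_trans (bound' _ Sw' _)); first by apply: le_lt_trans wk3; lra.
  by rewrite ler_wpM2l ?(ltW e0).
have B3 : `|f (x + w) - f (x' + w')| <= e * `|w|.
  apply: (le_trans (lip _ _ _ _)).
  - by rewrite xK; lra.
  - by rewrite addrAC; apply: (le_trans (ler_normD _ _)); lra.
  - have -> : x + w - (x' + w') = - (x' - (x + h *: e_ j)).
      by apply/matrixP => i z; rewrite !mxE; ring.
    rewrite normrN; apply: (@le_trans _ _ (k%:R * (c * `|w|))); first by rewrite ler_wpM2l.
    by rewrite mulrA ler_wpM2r.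
have B4 : `|f x' - f (x + h *: e_ j)| <= e * `|w|.
  apply: (le_trans (lip _ _ _ _)).
  - by lra.
  - by rewrite xK; have := he h; lra.
  - apply: (@le_trans _ _ (k%:R * (c * `|w|))); first by rewrite ler_wpM2l.
    by rewrite mulrA ler_wpM2r.
(* Four errors of size [e * |w|]: along [e_ j] at [x], along [S] at the nearby good point [x'], and
   two Lipschitz comparisons between [x'] and [x + h *: e_ j], at these points and after the further
   displacement [w']. *)
have -> : 4 * e * `|w| = e * `|w| + e * `|w| + (e * `|w| + e * `|w|) by ring.
have -> : error A w x = `|(f (x + h *: e_ j) - f x - A *m (h *: e_ j)) +
    (f (x' + w') - f x' - A *m w') +
    ((f (x + w) - f (x' + w')) + (f x' - f (x + h *: e_ j)))|.
  rewrite /error /w' mulmxBr; congr `|_|.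
  by apply/matrixP => i z; rewrite !mxE; ring.
apply: (le_trans (ler_normD _ _)); apply: lerD;
  by apply: (le_trans (ler_normD _ _)); apply: lerD.
Qed.

Lemma supported1 j w : supported [set j] w -> w = w j 0 *: e_ j.
Proof.
move=> wj; apply/matrixP => i z; rewrite (ord1 z) !mxE eqxx andbT.
case: eqP => [->|/eqP ij]; first by rewrite mulr1.
by rewrite mulr0; apply: wj; rewrite finset.in_set1.
Qed.

Lemma rat_mx_approx (A : 'M[R]_(n, m)) e : 0 < e ->
  exists B : 'M[rat]_(n, m), forall w : 'cV[R]_m, `|(A - map_mx ratr B) *m w| <= e * `|w|.
Proof.
move=> e0; pose d := e / (m%:R + 1).
have m1 : 0 < m%:R + 1 :> R by rewrite ltr_wpDl.
have d0 : 0 < d by exact: divr_gt0.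
have /choice[q Hq] : forall ij : 'I_n * 'I_m, exists q : rat, `|A ij.1 ij.2 - ratr q| <= d.
  move=> ij; have := @rat_in_itvoo R (A ij.1 ij.2 - d) (A ij.1 ij.2 + d).
  case; first by lra.
  by move=> q; rewrite in_itv /= => qx; exists q; rewrite ler_norml; lra.
exists (\matrix_(i, j) q (i, j)) => w; apply: (le_trans (mulmx_norm_le _ _)).
rewrite mulrA ler_wpM2r //; apply: (@le_trans _ _ (m%:R * d)).
  rewrite ler_wpM2l //; apply: mx_norm_le => [|i j]; first exact: ltW.
  by rewrite !mxE; exact: (Hq (i, j)).
by rewrite /d mulrA ler_pdivrMr // mulrC ler_wpM2l ?lerDl ?ltW.
Qed.

Lemma error_approx A B w x c : `|(A - B) *m w| <= c -> error B w x <= error A w x + c.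
Proof.
move=> ABc; rewrite /error.
have -> : f (x + w) - f x - B *m w = f (x + w) - f x - A *m w + (A - B) *m w.
  by rewrite mulmxBl addrA subrK.
by apply: (le_trans (ler_normD _ _)); rewrite lerD2l.
Qed.

(** The column [j] is taken from [A2] and the others from [A1]; as [j] is not in [S], the two
    conditions read disjoint sets of columns. *)
Lemma differentiable_on_glue (S : {set 'I_m}) j x A1 A2 : j \notin S ->
  differentiable_on S x A1 -> differentiable_on [set j] x A2 ->
  exists A, differentiable_on S x A /\ differentiable_on [set j] x A.
Proof.
move=> jS d1 d2.
exists (\matrix_(i, c) if c == j then A2 i c else A1 i c); set A := \matrix_(i, c) _.
have A1E w : supported S w -> A *m w = A1 *m w.
  move=> Sw; apply/matrixP => i z; rewrite (ord1 z) !mxE; apply: eq_bigr => c _.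
  by rewrite mxE; case: eqP => // ->; rewrite Sw // !mulr0.
have A2E w : supported [set j] w -> A *m w = A2 *m w.
  move=> jw; apply/matrixP => i z; rewrite (ord1 z) !mxE; apply: eq_bigr => c _.
  by rewrite mxE; case: eqP => // /eqP cj; rewrite jw ?finset.in_set1 // !mulr0.
split=> e e0.
  by have [d d0 Hd] := d1 e e0; exists d => // w Sw; rewrite /error A1E //; exact: Hd.
by have [d d0 Hd] := d2 e e0; exists d => // w Sw; rewrite /error A2E //; exact: Hd.
Qed.

(** The parameters of [good] and [bad] are made countable: a rational matrix, a tolerance [ep l] and
    a scale [k]. Each exceptional point falls into one of the resulting null sets. *)
Lemma differentiable_on_setU1_null (S : {set 'I_m}) j : j \notin S ->
  null_cols [set x | [/\ exists A, differentiable_on S x A,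
    exists A, differentiable_on [set j] x A & ~ exists A, differentiable_on (j |: S) x A]].
Proof.
move=> jS; pose ep (l : nat) : R := 2 * l.+1%:R^-1.
pose F (p : 'M[rat]_(n, m) * nat * nat) := good S (map_mx ratr p.1.1) (ep p.1.2) p.2 `&`
  good [set j] (map_mx ratr p.1.1) (ep p.1.2) p.2 `&`
  bad (j |: S) (map_mx ratr p.1.1) (4 * ep p.1.2).
have : null_cols (\bigcup_p F p).
  by apply: null_cols_bigcup => p; apply: good_bad_null; rewrite mulr_gt0 ?invr_gt0.
apply: null_colsS => x [[A1 d1] [A2 d2] ndiff].
have [A [{}d1 {}d2]] := differentiable_on_glue jS d1 d2.
have [e e0 He] : exists2 e, 0 < e & forall d, 0 < d ->
    exists w, [/\ supported (j |: S) w, `|w| < d & e * `|w| < error A w x].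
  apply: contrapT => nH; apply: ndiff; exists A => e e0.
  apply: contrapT => nd; apply: nH; exists e => // d d0.
  apply: contrapT => nw; apply: nd; exists d => // w Sw wd.
  by rewrite leNgt; apply/negP => ew; apply: nw; exists w.
(* With [ee = 1 / (l + 1)], the tolerance [ep l] is [2 * ee]: one [ee] from the expansion, one from
   replacing [A] by the rational [B]. The violation must exceed [4 * ep l = 8 * ee] after losing
   another [ee], whence 9. *)
have [l le9] : exists l : nat, l.+1%:R^-1 < e / 9 by apply: exists_natSinv_lt; rewrite divr_gt0.
pose ee : R := l.+1%:R^-1; rewrite -/ee in le9.
have ee0 : 0 < ee by rewrite invr_gt0.
have [B HB] := rat_mx_approx A ee0.
have [r1 r10 Hr1] := d1 _ ee0; have [r2 r20 Hr2] := d2 _ ee0.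
have [L [r3 [L0 r30 HL]]] := (locally_lipschitzP f).1 fl x.
have [k0 k0r] : exists k : nat, k.+1%:R^-1 < Num.min r1 (Num.min r2 r3).
  by apply: exists_natSinv_lt; rewrite !lt_min r10 r20.
(* The one index [k] both bounds the Lipschitz constant and sets the radius [1 / (k + 1)]; enlarging
   it helps with both. *)
pose k := maxn k0 (Num.truncn L).+1.
have Lk : L <= k%:R.
  apply: (@le_trans _ _ (Num.truncn L).+1%:R); first by apply/ltW/truncnS_gt.
  by rewrite ler_nat leq_maxr.
have {k0r} : k.+1%:R^-1 < Num.min r1 (Num.min r2 r3).
  apply: le_lt_trans k0r; rewrite lef_pV2 ?posrE // ler_nat ltnS.
  exact: leq_maxl.
rewrite !lt_min => /and3P[kr1 kr2 kr3].
have lip y z : `|y - x| < k.+1%:R^-1 -> `|z - x| < k.+1%:R^-1 ->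
    `|f y - f z| <= k%:R * `|y - z|.
  move=> yk zk; apply: (le_trans (HL _ _ (lt_trans yk kr3) (lt_trans zk kr3))).
  exact: ler_wpM2r.
have errB w : error A w x <= ee * `|w| -> error (map_mx ratr B) w x <= ep l * `|w|.
  by move=> ?; apply: (le_trans (error_approx x (HB w))); rewrite /ep -/ee; lra.
exists (B, l, k) => //; split; [split|].
- by split => //= w Sw wk; apply: errB; apply: Hr1 => //; exact: lt_trans kr1.
- by split => //= w Sw wk; apply: errB; apply: Hr2 => //; exact: lt_trans kr2.
- move=> i _; have [|w [Sw wi ew]] := He i.+1%:R^-1; first by rewrite invr_gt0.
  exists w => //=.
  have : error A w x <= error (map_mx ratr B) w x + ee * `|w|.
    by apply: error_approx; rewrite -opprB mulNmx normrN; exact: HB.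
  have w0 : 0 <= `|w| by [].
  have := ler_wpM2r w0 (ltW le9).
  by rewrite /ep -/ee; lra.
Qed.

Lemma derivable_ae_line x0 v : mu.-negligible [set s : R | ~ derivable f (x0 + s *: v) v].
Proof.
apply: (@ae_unit_intervals _ (fun s => derivable f (x0 + s *: v) v)) => k.
have := ae_derivable_curve (line_absolutely_continuous (x0 + k%:~R *: v) v fl).
apply: negligibleS => t; apply: contra_not => Ht /Ht /derivableP /is_derive_lineP.
by rewrite -addrA -scalerDl [k%:~R + t]addrC => -[].
Qed.

(** The failure of the Cauchy criterion, with tolerances and radii of the form [1 / (l + 1)], is the
    Borel set [N]; on each line parallel to [e_ j] it is null because curves are derivable almost
    everywhere. *)
Lemma not_derivable_null j : null_cols [set x | ~ derivable f x (e_ j)].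
Proof.
pose q (h : R) x := h^-1 *: (f (x + h *: e_ j) - f x).
have qc h : continuous (q h).
  move=> x; have sh : y + h *: e_ j @[y --> x] --> x + h *: e_ j.
    exact: (cvgD cvg_id (cvg_cst (h *: e_ j))).
  exact: (cvgZl_tmp (cvgB (cvg_comp _ _ sh (@fc _)) (@fc x))).
pose N := \bigcup_(l : nat) \bigcap_(k : nat) \bigcup_(p in
    [set p : R * R | 0 < `|p.1| < k.+1%:R^-1 /\ 0 < `|p.2| < k.+1%:R^-1])
  [set x | l.+1%:R^-1 < `|q p.1 x - q p.2 x|].
have mN : measurable_cols N.
  rewrite /measurable_cols preimage_bigcup; apply: bigcupT_measurable => l.
  rewrite preimage_bigcap; apply: bigcap_measurable => [|k _]; first by exists 0%N.
  apply: open_measurable_cols; apply: bigcup_open => p _.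
  rewrite (_ : [set x | _] = (fun x => `|q p.1 x - q p.2 x|) @^-1` [set r | l.+1%:R^-1 < r]) //.
  apply: open_comp; last exact: open_gt.
  by move=> x _; exact: (cvg_norm (cvgB (@qc _ _) (@qc _ _))).
have Nder x : N x -> ~ derivable f x (e_ j).
  move=> [l _ Nx] /derivable_cauchyP H.
  have l0 : 0 < l.+1%:R^-1 :> R by rewrite invr_gt0.
  have [d d0 Hd] := H _ l0; have [k kd] := exists_natSinv_lt d0.
  have [p [/andP[p1 pk1] /andP[p2 pk2]] /=] := Nx k I.
  apply/negP; rewrite -leNgt; apply: Hd.
    by rewrite p1 (lt_trans pk1).
  by rewrite p2 (lt_trans pk2).
have : null_cols N.
  apply: (null_cols_lines (j := j)) => // x0.
  by apply: negligibleS (derivable_ae_line x0 (e_ j)) => s /Nder.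
apply: null_colsS => x nder; apply: contrapT => nN; apply: nder; apply/derivable_cauchyP => e e0.
have [l le] := exists_natSinv_lt e0.
apply: contrapT => nd; apply: nN; exists l => // k _.
apply: contrapT => nk; apply: nd; exists k.+1%:R^-1; first by rewrite invr_gt0.
move=> h h' hk h'k; rewrite leNgt; apply/negP => eh; apply: nk.
by exists (h, h') => //=; exact: lt_trans eh.
Qed.

Lemma derivable_differentiable_on j x : derivable f x (e_ j) ->
  exists A, differentiable_on [set j] x A.
Proof.
move=> /derivableP /is_derive_approxP H.
(* All columns are equal; displacements along [e_ j] only see the [j]-th one. *)
exists (\matrix_(i, c) ('D_(e_ j) f x) i 0) => e e0.
have [d d0 Hd] := H e e0; exists d => // w wj wd.
have wjd := mx_entry_le_norm w j 0.
apply: (@le_trans _ _ (e * `|w j 0|)); last by rewrite ler_wpM2l ?(ltW e0).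
rewrite /error; have -> : (\matrix_(i, c) ('D_(e_ j) f x) i 0) *m w = w j 0 *: 'D_(e_ j) f x.
  apply/matrixP => i z; rewrite (ord1 z) !mxE (bigD1 j) //= big1 => [|c cj].
    by rewrite mxE addr0 mulrC.
  by rewrite (wj c) ?mulr0 // finset.in_set1.
by rewrite (supported1 wj) !mxE eqxx mulr1; apply: Hd; exact: le_lt_trans wd.
Qed.

(** Coordinates are added one at a time. A new exceptional point was exceptional before, or is not
    derivable along [e_ j], or lies in the null set where the two kinds of differentiability do not
    combine. *)
Lemma not_differentiable_on_null (s : seq 'I_m) :
  null_cols [set x | ~ exists A, differentiable_on [set i in s] x A].
Proof.
elim: s => [|j s IH].
  apply: (@null_colsS _ _ _ set0) => [x []|].
    exists 0 => e e0; exists 1 => // w Sw _.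
    have -> : w = 0 by apply/matrixP => i z; rewrite (ord1 z) Sw ?mxE // finset.inE.
    by rewrite /error addr0 mulmx0 !subrr !normr0 mulr0.
  exists set0; split => //; have [nu <-] := @lebesgue_tuple_sigma_finite R m; exact: measure0.
have [js|js] := boolP (j \in s).
  rewrite (_ : [set i in j :: s] = [set i in s]) //.
  by apply/setP => i; rewrite !finset.inE; case: eqP => // ->.
have jS : j \notin [set i in s] by rewrite finset.inE.
apply: null_colsS (null_colsU (null_colsU IH (not_derivable_null j))
  (differentiable_on_setU1_null jS)) => x nx.
have [d1|] := pselect (exists A, differentiable_on [set i in s] x A); last by left; left.
have [dj|] := pselect (derivable f x (e_ j)); last by left; right.
right; split => //; first exact: derivable_differentiable_on.
by move: nx; rewrite /= (_ : [set i in j :: s] = j |: [set i in s]) //;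
  apply/setP => i; rewrite !finset.inE.
Qed.

Lemma rademacher : null_cols [set x | ~ differentiable f x].
Proof.
apply: null_colsS (not_differentiable_on_null (enum 'I_m)) => x ndx [A dA]; apply: ndx.
apply: (@differentiable_approx _ _ _ _ _ (mulmx A)); first exact: mulmx_continuous.
move=> e e0; have [d d0 Hd] := dA e e0; exists d => // w wd; apply: Hd => //.
by move=> i; rewrite finset.inE mem_enum.
Qed.

End rademacher.

(** * The chain rule almost everywhere *)

Section closed_graph.
Context {R : realType}.

Lemma vec_mx_continuous q n : continuous (vec_mx : 'rV[R]_(q * n) -> 'M[R]_(q, n)).
Proof.
move=> v; apply/(@cvgrPdist_le _ _ _ (nbhs v)) => e e0.
apply/nbhs_ballP; exists e => // w; rewrite -ball_normE /= => vw.
rewrite -linearB; apply: mx_norm_le => [|i j]; first exact: ltW.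
by rewrite mxE; apply: (le_trans (mx_entry_le_norm _ _ _)); exact: ltW.
Qed.

(** Heine-Borel for row vectors, transported by the continuous map [vec_mx]. *)
Lemma closed_mx_ball_compact q n (M : R) : compact [set V : 'M[R]_(q, n) | `|V| <= M].
Proof.
have -> : [set V : 'M[R]_(q, n) | `|V| <= M] = vec_mx @` [set v : 'rV[R]_(q * n) | `|v| <= M].
  apply/seteqP; split => [V VM|_ [v vM <-]] /=.
    exists (mxvec V); last exact: mxvecK.
    apply: le_trans VM; apply: mx_norm_le => // i j; rewrite (ord1 i).
    by case/mxvec_indexP: j => a b; rewrite mxvecE; exact: mx_entry_le_norm.
  apply: le_trans vM; apply: mx_norm_le => // i j.
  by rewrite mxE; exact: mx_entry_le_norm.
apply: continuous_compact.
  by apply: continuous_subspaceT => v; exact: vec_mx_continuous.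
apply: bounded_closed_compact.
  by exists M; split; [exact: num_real | move=> x Mx v /= vM; exact: le_trans (ltW Mx)].
rewrite (_ : [set v | _] = (fun v : 'rV[R]_(q * n) => `|v|) @^-1` [set r | r <= M]) //.
by apply: closed_comp; [move=> v _; exact: norm_continuous | exact: closed_le].
Qed.

(** The tube lemma: projection along a compact factor is closed. *)
Lemma compact_section_closed (X Y : topologicalType) (K : set Y) (G : set (X * Y)) :
  compact K -> closed G -> closed [set x | exists2 y, K y & G (x, y)].
Proof.
move=> /compact_near_coveringP Kc Gcl.
rewrite -openC openE => x nx.
have H : \forall x' \near x, K `<=` (fun y => ~ G (x', y)).
  apply: (Kc X (nbhs x) (fun x y => ~ G (x, y)) (nbhs_filter x)) => y Ky.
  have : nbhs (x, y) (~` G).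
    by apply: open_nbhs_nbhs; split; [rewrite openC | move=> Gxy; apply: nx; exists y].
  case=> -[A B] /= [nA nB] AB.
  by exists (B, A) => // -[y' x'] /= [By' Ax']; exact: (AB (x', y')).
by rewrite /interior; apply: filterS H => x' Hx' [y Ky]; exact: Hx'.
Qed.

(* Upper semicontinuity of a set-valued map with closed graph, in the form in
   which it is used: [J] cannot jump away from the solutions of [V *m u = v]. *)
Lemma closed_graph_usc n q (J : 'cV[R]_n -> set 'M[R]_(q, n)) (M eta : R)
    (u : 'cV[R]_n) (v : 'cV[R]_q) :
  closed [set z : 'cV[R]_n * 'M[R]_(q, n) | J z.1 z.2] ->
  closed [set z | exists V, [/\ `|V| <= M, J z V & eta <= `|V *m u - v|]].
Proof.
move=> Jcl.
rewrite (_ : [set z | _] = [set z | exists2 V, `|V| <= M &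
  ([set z | J z.1 z.2] `&` [set z : 'cV[R]_n * 'M[R]_(q, n) | eta <= `|z.2 *m u - v|]) (z, V)]).
  apply: (compact_section_closed (K := [set V : 'M[R]_(q, n) | `|V| <= M])).
    exact: closed_mx_ball_compact.
  apply: closedI => //.
  have Bcl : closed [set V : 'M[R]_(q, n) | eta <= `|V *m u - v|].
    have -> : [set V : 'M[R]_(q, n) | eta <= `|V *m u - v|] =
      (fun V : 'M[R]_(q, n) => `|V *m u - v|) @^-1` [set r | eta <= r] by [].
    apply: closed_comp; last exact: closed_ge.
    move=> V _; have cu : W *m u @[W --> V] --> V *m u.
      apply/(@cvgrPdist_le _ _ _ (nbhs V)) => e e0.
      pose K := n%:R * `|u| + 1.
      have K0 : 0 < K by rewrite ltr_wpDl // mulr_ge0.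
      apply/nbhs_ballP; exists (e / K); first exact: divr_gt0.
      move=> W; rewrite -ball_normE /= ltr_pdivlMr // => We.
      rewrite -mulmxBl; apply: (le_trans (mulmx_norm_le _ _)).
      by rewrite mulrCA; move: We (normr_ge0 (V - W)); rewrite /K; lra.
    exact: (cvg_norm (cvgB cu (cvg_cst v))).
  by apply: (closed_comp (f := snd)) Bcl => z _; exact: cvg_snd.
apply/seteqP; split => z [V].
  by move=> [VM JV Ve]; exists V.
by move=> VM [JV Ve]; exists V.
Qed.

End closed_graph.

Section chain_rule.
Context {R : realType} (m n q : nat).
Variables (F : 'cV[R]_n -> 'cV[R]_q) (J : 'cV[R]_n -> set 'M[R]_(q, n)).
Variable g : 'cV[R]_m -> 'cV[R]_n.
Hypotheses (Jcl : closed [set z : 'cV[R]_n * 'M[R]_(q, n) | J z.1 z.2])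
  (Jchain : chain_rule_along_curves F J) (gl : locally_lipschitz g)
  (Fgl : locally_lipschitz (F \o g)).
Local Notation mu := (@lebesgue_measure R).
Local Notation e_ j := (delta_mx j 0 : 'cV[R]_m).

Lemma chain_rule_ae_line x0 v : mu.-negligible [set s : R | ~ (derivable g (x0 + s *: v) v /\
  forall V, J (g (x0 + s *: v)) V ->
    is_derive (x0 + s *: v) v (F \o g) (V *m 'D_v g (x0 + s *: v)))].
Proof.
apply: (@ae_unit_intervals _ (fun s => derivable g (x0 + s *: v) v /\
  forall V, J (g (x0 + s *: v)) V ->
    is_derive (x0 + s *: v) v (F \o g) (V *m 'D_v g (x0 + s *: v)))) => k.
have := Jchain (line_absolutely_continuous (x0 + k%:~R *: v) v gl).
apply: negligibleS => t; apply: contra_not => Ht /Ht[/derivableP /is_derive_lineP gt Vt].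
have lineE : x0 + k%:~R *: v + t *: v = x0 + (t + k%:~R) *: v.
  by rewrite -addrA -scalerDl [k%:~R + t]addrC.
rewrite lineE in gt Vt.
split; first exact: (@ex_derive _ _ _ _ _ _ _ gt).
move=> V /Vt; rewrite (@derive_val _ _ _ _ _ _ _ gt) -lineE => dF.
by apply/is_derive_lineP.
Qed.

Lemma difference_closed p (f : 'cV[R]_m -> 'cV[R]_p) v a e d : continuous f ->
  closed [set x | forall h : R, `|h| < d -> `|f (x + h *: v) - f x - h *: a| <= e * `|h|].
Proof.
move=> fc.
rewrite (_ : [set x | _] = \bigcap_(h in [set h : R | `|h| < d])
  ((fun x => `|f (x + h *: v) - f x - h *: a|) @^-1` [set r | r <= e * `|h|])).
  apply: closed_bigI => h _; apply: closed_comp; last exact: closed_le.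
  move=> x _; have sh : y + h *: v @[y --> x] --> x + h *: v.
    exact: (cvgD cvg_id (cvg_cst (h *: v))).
  exact: (cvg_norm (cvgB (cvgB (cvg_comp _ _ sh (@fc _)) (@fc x)) (cvg_cst (h *: a)))).
by apply/seteqP; split => x H h; exact: H.
Qed.

Lemma derive_near_rate p (f : 'cV[R]_m -> 'cV[R]_p) x v a e d : 0 < d -> derivable f x v ->
  (forall h : R, `|h| < d -> `|f (x + h *: v) - f x - h *: a| <= e * `|h|) ->
  `|'D_v f x - a| <= e.
Proof.
move=> d0 /derivableP /is_derive_approxP df Ha; apply/ler_addgt0Pr => e' e'0.
have [d' d'0 Hd'] := df _ e'0.
pose h := Num.min d d' / 2.
have m0 : 0 < Num.min d d' by rewrite lt_min d0.
have h0 : 0 < h by rewrite divr_gt0.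
have hm : `|h| < Num.min d d' by rewrite gtr0_norm // /h; lra.
move: (hm); rewrite lt_min => /andP[hd hd'].
have := Hd' h hd'; have := Ha h hd.
rewrite (gtr0_norm h0) => H1 H2; rewrite -(ler_pM2l h0) -[X in X * `|_|](gtr0_norm h0) -normrZ.
have -> : h *: ('D_v f x - a) = (f (x + h *: v) - f x - h *: a) - (f (x + h *: v) - f x - h *: 'D_v f x).
  by set X := f _ - f x; rewrite scalerBr opprB [RHS]addrC addrA subrK.
by apply: (le_trans (ler_normB _ _)); lra.
Qed.

Lemma rat_cV_approx p (a : 'cV[R]_p) e : 0 < e -> exists b : 'cV[rat]_p, `|a - map_mx ratr b| <= e.
Proof.
move=> e0; have /choice[b Hb] : forall i : 'I_p, exists b : rat, `|a i 0 - ratr b| <= e.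
  move=> i; have := @rat_in_itvoo R (a i 0 - e) (a i 0 + e).
  case; first by lra.
  by move=> b; rewrite in_itv /= => ?; exists b; rewrite ler_norml; lra.
exists (\col_i b i); apply: mx_norm_le => [|i z]; first exact: ltW.
by rewrite (ord1 z) !mxE; exact: Hb.
Qed.

(** The set is covered by countably many Borel sets [N p]. There [a] and [b] are rational
    approximate rates of [g] and [F \o g] at scale [1 / (k + 1)], and some [V] in [J] of norm at
    most [M] sends [a] far from [b]. Where the chain rule holds along a line, [V *m a] is within
    half that gap of [b], so [N p] is null on lines. *)
Lemma chain_rule_null j : null_cols [set x | [/\ derivable g x (e_ j), derivable (F \o g) x (e_ j)
  & exists2 V, J (g x) V & 'D_(e_ j) (F \o g) x <> V *m 'D_(e_ j) g x]].
Proof.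
have gc := locally_lipschitz_continuous gl; have Fgc := locally_lipschitz_continuous Fgl.
pose ep (l : nat) : R := 2 * l.+1%:R^-1.
have ep0 l : 0 < ep l by rewrite mulr_gt0 ?invr_gt0.
pose C p (f : 'cV[R]_m -> 'cV[R]_p) (a : 'cV[rat]_p) l k := [set x | forall h : R,
  `|h| < k.+1%:R^-1 -> `|f (x + h *: e_ j) - f x - h *: map_mx ratr a| <= ep l * `|h|].
pose E (a : 'cV[rat]_n) (b : 'cV[rat]_q) l (M : nat) := g @^-1` [set z | exists V, [/\ `|V| <= M%:R, J z V &
   2 * ep l * (n%:R * M%:R + 1) <= `|V *m map_mx ratr a - map_mx ratr b|]].
pose N (p : 'cV[rat]_n * 'cV[rat]_q * nat * nat * nat) :=
  let: (a, b, l, k, M) := p in C _ g a l k `&` C _ (F \o g) b l k `&` E a b l M.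
have Nnull p : null_cols (N p).
  case: p => [[[[a b] l] k] M]; apply: (null_cols_lines (j := j)).
    apply: measurableI; last first.
      apply: closed_measurable_cols; apply: closed_comp; first by move=> x _; exact: gc.
      exact: closed_graph_usc.
    by apply: measurableI; apply: closed_measurable_cols; exact: difference_closed.
  move=> x0; apply: negligibleS (chain_rule_ae_line x0 (e_ j)) => s [[Ca Cb] [V [VM JV Ve]]].
  move=> [dg dFg]; have dFgV := dFg V JV.
  have k0 : 0 < k.+1%:R^-1 :> R by rewrite invr_gt0.
  have ra := derive_near_rate k0 dg Ca.
  have rb := derive_near_rate k0 (@ex_derive _ _ _ _ _ _ _ dFgV) Cb.
  rewrite (@derive_val _ _ _ _ _ _ _ dFgV) in rb; set D := 'D_(e_ j) g _ in ra rb.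
  have : `|V *m map_mx ratr a - map_mx ratr b| <= ep l * (n%:R * M%:R + 1).
    have -> : V *m map_mx ratr a - map_mx ratr b =
      (V *m D - map_mx ratr b) - V *m (D - map_mx ratr a).
      by rewrite mulmxBr opprB [RHS]addrC addrA subrK.
    apply: (le_trans (ler_normB _ _)); rewrite mulrDr mulr1 addrC; apply: lerD => //.
    apply: (le_trans (mulmx_norm_le _ _)).
    by rewrite [leRHS]mulrC -mulrA ler_wpM2l // ler_pM.
  move=> /(le_trans Ve); apply/negP; rewrite -ltNge.
  have : 0 < ep l * (n%:R * M%:R + 1) by rewrite mulr_gt0 // ltr_wpDl // mulr_ge0.
  by rewrite -mulrA; lra.
have : null_cols (\bigcup_p N p) by exact: null_cols_bigcup.
apply: null_colsS => x [dg dFg [V JV VD]].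
pose D := 'D_(e_ j) g x; pose G := 'D_(e_ j) (F \o g) x; rewrite -/D -/G in VD.
pose tau := `|V *m D - G|.
have tau0 : 0 < tau by rewrite normr_gt0 subr_eq0; apply/eqP => VDG; exact: VD.
pose M := (Num.truncn `|V|).+1.
have VM : `|V| <= M%:R by apply/ltW/truncnS_gt.
pose K : R := n%:R * M%:R + 1.
have K0 : 0 < K by rewrite ltr_wpDl // mulr_ge0.
(* Passing to rational rates costs at most [ee * K], and the gap demanded in [E] is
   [2 * ep l * K = 4 * ee * K]; hence the factor 5. *)
have [l ltau] : exists l : nat, l.+1%:R^-1 < tau / (5 * K).
  by apply: exists_natSinv_lt; rewrite divr_gt0 // mulr_gt0.
pose ee : R := l.+1%:R^-1; rewrite -/ee in ltau.
have ee0 : 0 < ee by rewrite invr_gt0.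
have [a Da] := rat_cV_approx D ee0; have [b Gb] := rat_cV_approx G ee0.
have rate p (f : 'cV[R]_m -> 'cV[R]_p) c : derivable f x (e_ j) ->
    `|'D_(e_ j) f x - map_mx ratr c| <= ee ->
    exists2 d : R, 0 < d & forall k, k.+1%:R^-1 < d -> C p f c l k x.
  move=> /derivableP /is_derive_approxP df fc; have [d d0 Hd] := df _ ee0.
  exists d => // k kd h hk; have := Hd h (lt_trans hk kd) => H.
  have -> : f (x + h *: e_ j) - f x - h *: map_mx ratr c =
    (f (x + h *: e_ j) - f x - h *: 'D_(e_ j) f x) + h *: ('D_(e_ j) f x - map_mx ratr c).
    by rewrite scalerBr addrA subrK.
  apply: (le_trans (ler_normD _ _)); rewrite normrZ.
  have := ler_wpM2l (normr_ge0 h) fc; rewrite /ep -/ee.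
  by rewrite [_ * ee]mulrC; lra.
have [d1 d10 Hd1] := rate _ _ _ dg Da; have [d2 d20 Hd2] := rate _ _ _ dFg Gb.
have [k] : exists k : nat, k.+1%:R^-1 < Num.min d1 d2 by apply: exists_natSinv_lt; rewrite lt_min d10.
rewrite lt_min => /andP[k1 k2].
exists (a, b, l, k, M) => //; split; first by split; [exact: Hd1 | exact: Hd2].
exists V; split => //; rewrite -/K.
have : tau <= `|V *m map_mx ratr a - map_mx ratr b| + ee * K.
  rewrite /tau; have -> : V *m D - G =
      (V *m map_mx ratr a - map_mx ratr b) + (V *m (D - map_mx ratr a) - (G - map_mx ratr b)).
    by rewrite mulmxBr; apply/matrixP => i z; rewrite !mxE; ring.
  apply: (le_trans (ler_normD _ _)); rewrite lerD2l; apply: (le_trans (ler_normB _ _)).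
  rewrite /K mulrDr mulr1; apply: lerD => //; apply: (le_trans (mulmx_norm_le _ _)).
  by rewrite [leRHS]mulrC -mulrA ler_wpM2l // ler_pM.
move: ltau; rewrite ltr_pdivlMr ?mulr_gt0 // /ep -/ee.
by rewrite mulrCA -mulrA; lra.
Qed.

End chain_rule.

(** * Fixed points *)

(** Joins completeness with the normed structure of matrices, as Banach's fixed point theorem
    asks. *)
HB.instance Definition _ (R : realType) (m n : nat) := Complete.on 'M[R]_(m, n).

Section graph_maps.
Context {R : realType}.

Lemma norm_col_mx p m (a : 'cV[R]_p) (b : 'cV[R]_m) : `|col_mx a b| = Num.max `|a| `|b|.
Proof.
apply/eqP; rewrite eq_le; apply/andP; split.
  apply: mx_norm_le => [|i z]; first by rewrite le_max normr_ge0.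
  rewrite mxE le_max; case: (fintype.split i) => k; first by rewrite mx_entry_le_norm.
  by rewrite mx_entry_le_norm orbT.
rewrite ge_max; apply/andP; split; apply: mx_norm_le => // i z.
  by rewrite -(col_mxEu a b); exact: mx_entry_le_norm.
by rewrite -(col_mxEd a b); exact: mx_entry_le_norm.
Qed.

Lemma col_mxB p m (a a' : 'cV[R]_p) (b b' : 'cV[R]_m) :
  col_mx a b - col_mx a' b' = col_mx (a - a') (b - b').
Proof. by rewrite opp_col_mx add_col_mx. Qed.

Lemma lipschitz_locally_lipschitz m n (f : 'cV[R]_m -> 'cV[R]_n) :
  lipschitz f -> locally_lipschitz f.
Proof. by move=> fl x; exists setT => //; exact: filterT. Qed.

Lemma locally_lipschitz_comp m n q (f : 'cV[R]_m -> 'cV[R]_n) (g : 'cV[R]_n -> 'cV[R]_q) :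
  locally_lipschitz f -> locally_lipschitz g -> locally_lipschitz (g \o f).
Proof.
move=> fl gl; apply/locally_lipschitzP => x.
have [L [d [L0 d0 HL]]] := (locally_lipschitzP _).1 fl x.
have [K [r [K0 r0 HK]]] := (locally_lipschitzP _).1 gl (f x).
have L1 : 0 < L + 1 by rewrite ltr_wpDl.
exists (K * L), (Num.min d (r / (L + 1))); split; first exact: mulr_ge0.
  by rewrite lt_min d0 divr_gt0.
have fr y : `|y - x| < Num.min d (r / (L + 1)) -> `|y - x| < d /\ `|f y - f x| < r.
  rewrite lt_min => /andP[yd]; rewrite ltr_pdivlMr // => yr; split => //.
  apply: (le_lt_trans (HL _ _ yd _)); first by rewrite subrr normr0.
  by move: yr (normr_ge0 (y - x)); lra.
move=> y z /fr[yd yr] /fr[zd zr] /=.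
by apply: (le_trans (HK _ _ yr zr)); rewrite -mulrA ler_wpM2l // HL.
Qed.

Lemma locally_lipschitz_graph m p (f : 'cV[R]_m -> 'cV[R]_p) :
  locally_lipschitz f -> locally_lipschitz (fun x => col_mx (f x) x).
Proof.
move=> fl; apply/locally_lipschitzP => x.
have [L [d [L0 d0 HL]]] := (locally_lipschitzP _).1 fl x.
exists (L + 1), d; split => // [|y z yd zd]; first by rewrite addr_ge0.
rewrite col_mxB norm_col_mx ge_max mulrDl mul1r lerDr mulr_ge0 // andbT.
by apply: (le_trans (HL _ _ yd zd)); rewrite lerDl.
Qed.

Lemma is_derive_graph m p (f : 'cV[R]_m -> 'cV[R]_p) x v D :
  is_derive x v f D -> is_derive x v (fun y => col_mx (f y) y) (col_mx D v).
Proof.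
move=> /is_derive_approxP H; apply/is_derive_approxP => e e0.
have [d d0 Hd] := H e e0; exists d => // h hd.
have -> : col_mx (f (x + h *: v)) (x + h *: v) - col_mx (f x) x - h *: col_mx D v =
    col_mx (f (x + h *: v) - f x - h *: D) 0.
  by rewrite scale_col_mx !col_mxB [x + _]addrC addrK subrr.
rewrite norm_col_mx normr0 ge_max.
by rewrite Hd // mulr_ge0 // ltW.
Qed.

Lemma differentiable_usubmx m p q (f : 'cV[R]_m -> 'cV[R]_(p + q)) x :
  differentiable f x -> differentiable (fun y => usubmx (f y)) x.
Proof.
move=> df.
have H : differentiable (usubmx : 'cV[R]_(p + q) -> 'cV[R]_p) (f x).
  apply: (@differentiable_approx _ _ _ _ _ (usubmx : {linear 'cV[R]_(p + q) -> 'cV[R]_p})).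
    move=> y; apply/(@cvgrPdist_le _ _ _ (nbhs y)) => e e0.
    apply/nbhs_ballP; exists e => // w; rewrite -ball_normE /= => yw.
    rewrite -linearB; apply: mx_norm_le => [|i z]; first exact: ltW.
    by rewrite mxE; apply: (le_trans (mx_entry_le_norm _ _ _)); exact: ltW.
  move=> e e0; exists 1 => // w _.
  by rewrite -!linearB /= [_ + w]addrC addrK subrr linear0 normr0 mulr_ge0 // ltW.
exact: differentiable_comp.
Qed.

End graph_maps.

(** * The Euclidean contraction, its fixed point and the dependence on the parameter *)

Section contraction.
Context {R : realType} (p m : nat) (F : 'cV[R]_(p + m) -> 'cV[R]_p)
  (J : 'cV[R]_(p + m) -> set 'M[R]_(p, p + m)) (rho : R).
Hypotheses (Fl : locally_lipschitz F) (FJ : conservative_jacobian F J)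
  (rho0 : 0 <= rho) (rho1 : rho < 1).
Hypothesis Jrho : forall (x : 'cV[R]_p) (theta : 'cV[R]_m)
      (A : 'M[R]_(p, p)) (B : 'M[R]_(p, m)),
    J (col_mx x theta) (row_mx A B) -> opnorm A <= rho.

Lemma is_derive_dot n (u : 'cV[R]_n) (f : R -> 'cV[R]_n) (t : R) (D : 'cV[R]_n) :
  is_derive t 1 f D -> is_derive t 1 (fun s => dot u (f s)) (dot u D).
Proof.
move=> /is_derive_approxP H; apply/is_derive_approxP => e e0.
pose K := norm2 u * n%:R + 1.
have K0 : 0 < K by rewrite ltr_wpDl // mulr_ge0 // norm2_ge0.
have [d d0 Hd] := H _ (divr_gt0 e0 K0); exists d => // h hd.
rewrite -[h *: dot u D]/(h * dot u D) -dotZr -!dotBr.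
set w := _ - _ - _; have {}Hd : `|w| <= e / K * `|h| := Hd h hd.
apply: (le_trans (norm_dot_le _ _)).
apply: (@le_trans _ _ (K * `|w|)); last first.
  by rewrite mulrC -ler_pdivlMr // mulrAC.
rewrite /K mulrDl mul1r -mulrA.
by have := ler_wpM2l (norm2_ge0 u) (norm2_le_norm w); have := normr_ge0 w; lra.
Qed.

(** The increment [u] is tested against itself, which reduces to a scalar function [phi]. Its
    derivative is [dot u (V *m v)]; the lower block of [v] is zero, so only the block [A] of [V]
    acts and the derivative is at most [norm2 u * (rho * norm2 (y - x))]. Dividing by [norm2 u]
    concludes. *)
Lemma fixed_theta_contraction theta x y :
  norm2 (F (col_mx y theta) - F (col_mx x theta)) <= rho * norm2 (y - x).
Proof.
have [_ _ Jne Jchain] := FJ.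
set u := F _ - F _; pose z := col_mx x theta; pose v := col_mx (y - x) (0 : 'cV[R]_m).
have zv t : z + t *: v = col_mx (x + t *: (y - x)) theta.
  by rewrite /z /v scale_col_mx add_col_mx scaler0 addr0.
have [u0|u0] := eqVneq (norm2 u) 0; first by rewrite u0 mulr_ge0 // norm2_ge0.
have up : 0 < norm2 u by rewrite lt_def u0 norm2_ge0.
have [L L0 HL] := locally_lipschitz01 (line_locally_lipschitz z v Fl).
pose phi t := dot u (F (z + t *: v)).
have : phi 1 - phi 0 <= norm2 u * (rho * norm2 (y - x)).
  apply: (@lipschitz_ae_derive_le _ phi (norm2 u * p%:R * L)).
    move=> a b a0 ab b1; rewrite /phi -dotBr; apply: (le_trans (norm_dot_le _ _)).
    rewrite -!mulrA ler_wpM2l ?norm2_ge0 //; apply: (le_trans (norm2_le_norm _)).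
    by rewrite ler_wpM2l // HL.
  have idl : locally_lipschitz (@idfun 'cV[R]_(p + m)).
    apply/locally_lipschitzP => ?; exists 1, 1; split => // a b _ _.
    by rewrite mul1r.
  (* The inner map is the identity, so the curve is the segment itself. *)
  have := chain_rule_ae_line Jchain idl z v.
  apply: negligibleS => t; apply: contra_not => -[_ HV] _.
  have [V JV] := Jne (z + t *: v); have /is_derive_lineP dF := HV V JV.
  exists (dot u (V *m v)).
    have -> : V *m v = V *m 'D_v idfun (z + t *: v) by rewrite derive_id.
    exact: (is_derive_dot u dF).
  apply: (le_trans (dot_le_norm2 _ _)); rewrite ler_wpM2l ?norm2_ge0 //.
  rewrite -(hsubmxK V) mul_row_col mulmx0 addr0.
  apply: (le_trans (norm2_mulmx_le_opnorm _ _)); rewrite ler_wpM2r ?norm2_ge0 //.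
  by apply: (Jrho (B := rsubmx V) (theta := theta) (x := x + t *: (y - x))); rewrite hsubmxK -zv.
rewrite /phi -dotBr !zv scale1r scale0r addr0 (addrC x) subrK -/u dotvv expr2.
by rewrite ler_pM2l.
Qed.

Lemma iter_contraction theta k x y :
  norm2 (iter k (fun x => F (col_mx x theta)) y - iter k (fun x => F (col_mx x theta)) x) <=
    rho ^+ k * norm2 (y - x).
Proof.
elim: k => [|k IH]; first by rewrite expr0 mul1r.
apply: (le_trans (fixed_theta_contraction _ _ _)).
by rewrite exprS -mulrA ler_wpM2l.
Qed.

Lemma norm2_eq0 n (v : 'cV[R]_n) : norm2 v <= 0 -> v = 0.
Proof.
move=> v0; apply/normr0_eq0/eqP; rewrite eq_le normr_ge0 andbT.
exact: le_trans (norm_le_norm2 v) v0.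
Qed.

Lemma rho_expn_small (c e : R) : 0 < e -> exists K, forall k, (K <= k)%N -> rho ^+ k * c <= e.
Proof.
move=> e0; have c1 : 0 < `|c| + 1 by rewrite ltr_wpDl.
have : rho ^+ k @[k --> \oo] --> (0 : R) by apply: cvg_expr; rewrite ger0_norm.
move=> /cvgrPdist_le /(_ _ (divr_gt0 e0 c1))[K _ HK]; exists K => k Kk.
have := HK k Kk; rewrite /= sub0r normrN ger0_norm ?exprn_ge0 // ler_pdivlMr // => H.
apply: le_trans H; rewrite ler_wpM2l ?exprn_ge0 //.
by apply: le_trans (ler_norm c) _; rewrite lerDl.
Qed.

Lemma fixed_point_unique theta x y :
  F (col_mx x theta) = x -> F (col_mx y theta) = y -> x = y.
Proof.
move=> Fx Fy; apply/subr0_eq/norm2_eq0.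
have := fixed_theta_contraction theta y x; rewrite Fx Fy.
have := norm2_ge0 (x - y); set a := norm2 _ => a0 H.
by rewrite leNgt; apply/negP => ap; move: H; rewrite leNgt -[X in _ < X]mul1r ltr_pM2r ?rho1.
Qed.

(** The contraction is Euclidean, whereas completeness is used in the max norm. The factor [p]
    between the norms is absorbed by an iterate [K] with [rho ^+ K * (p + 1) <= 1 / 2], to which
    Banach's theorem applies. *)
Lemma fixed_point_exists theta : exists x, F (col_mx x theta) = x.
Proof.
pose G (x : 'cV[R]_p) := F (col_mx x theta).
have [K HK] := @rho_expn_small (p%:R + 1) (1 / 2) ltac:(by rewrite divr_gt0).
have {}HK : rho ^+ K * (p%:R + 1) <= 1 / 2 by exact: HK.
have iterL x y : `|iter K G x - iter K G y| <= 1 / 2 * `|x - y|.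
  apply: (le_trans (norm_le_norm2 _)); apply: (le_trans (iter_contraction _ _ _ _)).
  apply: (@le_trans _ _ (rho ^+ K * (p%:R * `|x - y|))).
    by rewrite ler_wpM2l ?exprn_ge0 // norm2_le_norm.
  have := ler_wpM2r (normr_ge0 (x - y)) HK; apply: le_trans.
  by rewrite mulrA ler_wpM2r // ler_wpM2l ?exprn_ge0 // lerDl.
pose GK : {fun [set: 'cV[R]_p] >-> [set: 'cV[R]_p]} := totalfun (iter K G).
have ctr : is_contraction GK.
  exists (1 / 2)%:nng; split; first by rewrite /=; lra.
  by move=> [x y] _ /=; exact: iterL.
have [x _ xG] := banach_fixed_point ctr closedT (ex_intro _ 0 I).
exists x; have {}xG : x = iter K G x := xG.
(* [G x] is again a fixed point of the [K]-th iterate, so its distance to [x] is at most half of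
   itself. *)
apply/subr0_eq/normr0_eq0.
have := iterL (G x) x; rewrite -iterSr iterS -xG -/(G x).
by have := normr_ge0 (G x - x); lra.
Qed.

Section fixed_point_map.
Variable xbar : 'cV[R]_m -> 'cV[R]_p.
Hypothesis xbarE : forall theta, F (col_mx (xbar theta) theta) = xbar theta.

(** Insert [F (col_mx (xbar theta') theta)]: the change of state is contracted by [rho] and absorbed
    on the left, leaving the change of parameter at a fixed state. *)
Lemma fixed_point_increment theta theta' :
  (1 - rho) * `|xbar theta - xbar theta'| <=
    p%:R * `|F (col_mx (xbar theta') theta) - F (col_mx (xbar theta') theta')|.
Proof.
apply: (@le_trans _ _ ((1 - rho) * norm2 (xbar theta - xbar theta'))).
  by rewrite ler_wpM2l ?norm_le_norm2 // subr_ge0 ltW.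
have := fixed_theta_contraction theta (xbar theta') (xbar theta).
have := norm2D (F (col_mx (xbar theta) theta) - F (col_mx (xbar theta') theta))
  (F (col_mx (xbar theta') theta) - F (col_mx (xbar theta') theta')).
rewrite subrKA !xbarE => H1 H2.
have := norm2_le_norm (F (col_mx (xbar theta') theta) - xbar theta').
by move: H1 H2; lra.
Qed.

Lemma fixed_point_locally_lipschitz : locally_lipschitz xbar.
Proof.
apply/locally_lipschitzP => theta0.
have [L [d [L0 d0 HL]]] := (locally_lipschitzP _).1 Fl (col_mx (xbar theta0) theta0).
pose K := p%:R * L / (1 - rho).
have r0 : 0 < 1 - rho by rewrite subr_gt0.
have K0 : 0 <= K by rewrite divr_ge0 ?mulr_ge0 // ltW.
have incr theta theta' : `|xbar theta' - xbar theta0| < d -> `|theta - theta0| < d ->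
    `|theta' - theta0| < d -> `|xbar theta - xbar theta'| <= K * `|theta - theta'|.
  move=> xd td t'd; rewrite /K mulrAC ler_pdivlMr // mulrC.
  apply: (le_trans (fixed_point_increment _ _)); rewrite -mulrA ler_wpM2l //.
  have := HL (col_mx (xbar theta') theta) (col_mx (xbar theta') theta').
  rewrite !col_mxB !norm_col_mx !gt_max subrr normr0 xd td t'd => /(_ isT isT).
  by rewrite max_r.
have K1 : 0 < K + 1 by rewrite ltr_wpDl.
(* [incr] needs [xbar theta'] within [d] of [xbar theta0]. Applied first with the state frozen at
   [theta0], it yields that closeness on the radius [d / (K + 1)]; then it applies to any pair. *)
exists K, (Num.min d (d / (K + 1))); split => //; first by rewrite lt_min d0 divr_gt0.
move=> theta theta'; rewrite !lt_min => /andP[td _] /andP[t'd t'K].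
apply: (incr _ _) => //; apply: (le_lt_trans (incr theta' theta0 _ t'd _)).
- by rewrite subrr normr0.
- by rewrite subrr normr0.
- move: t'K; rewrite ltr_pdivlMr //; have := normr_ge0 (theta' - theta0); lra.
Qed.
End fixed_point_map.

End contraction.

(** * Perturbed contracting recursions of real numbers *)

Section recursion.
Context {R : realType}.

(** Once [r k] is below [(1 - rho) * (e / 2)], the level [e / 2] is preserved by the recursion and
    the excess over it decays like [rho ^+ i]. *)
Lemma contracted_cvg0 (rho : R) (a r : nat -> R) : 0 <= rho -> rho < 1 ->
  (forall k, 0 <= a k) -> (forall k, a k.+1 <= rho * a k + r k) ->
  r k @[k --> \oo] --> (0 : R) -> a k @[k --> \oo] --> (0 : R).
Proof.
move=> rho0 rho1 a0 ar r0; apply/cvgrPdist_le => e e0.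
have e20 : 0 < e / 2 by rewrite divr_gt0.
have r1 : 0 < (1 - rho) * (e / 2) by rewrite mulr_gt0 // subr_gt0.
have [K _ HK] := (cvgrPdist_le _ _).1 r0 _ r1.
have aK i : a (K + i)%N <= rho ^+ i * a K + e / 2.
  elim: i => [|i IH]; first by rewrite addn0 expr0 mul1r lerDl ltW.
  rewrite addnS; apply: (le_trans (ar _)).
  have := HK (K + i)%N (leq_addr _ _); rewrite /= sub0r normrN => /(le_trans (ler_norm _)).
  have := ler_wpM2l rho0 IH; rewrite exprS; lra.
have [I HI] := @rho_expn_small _ rho rho0 rho1 (a K) _ e20.
exists (K + I)%N => // k /= Kk; rewrite sub0r normrN ger0_norm //.
have := aK (k - K)%N; rewrite subnKC ?(leq_trans (leq_addr _ _) Kk) //.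
by have := HI (k - K)%N; rewrite leq_subRL ?(leq_trans (leq_addr _ _) Kk) // => /(_ Kk); lra.
Qed.

End recursion.

(** * Convergence of the Jacobians *)

Section recursion.
Context {R : realType} (p m : nat) (F : 'cV[R]_(p + m) -> 'cV[R]_p)
  (J : 'cV[R]_(p + m) -> set 'M[R]_(p, p + m)) (rho : R).
Hypotheses (Fl : locally_lipschitz F) (FJ : conservative_jacobian F J)
  (rho0 : 0 <= rho) (rho1 : rho < 1).
Hypothesis Jrho : forall (x : 'cV[R]_p) (theta : 'cV[R]_m)
      (A : 'M[R]_(p, p)) (B : 'M[R]_(p, m)),
    J (col_mx x theta) (row_mx A B) -> opnorm A <= rho.

Definition graph (h : 'cV[R]_m -> 'cV[R]_p) theta := col_mx (h theta) theta.

(** Coordinate directions suffice for the chain rule, because Jacobians are compared column by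
    column. *)
Definition irregular (h : 'cV[R]_m -> 'cV[R]_p) : set 'cV[R]_m :=
  [set theta | ~ differentiable (graph h) theta] `|` \bigcup_(j : 'I_m)
  [set theta | [/\ derivable (graph h) theta (delta_mx j 0),
     derivable (F \o graph h) theta (delta_mx j 0)
  & exists2 V, J (graph h theta) V &
      'D_(delta_mx j 0) (F \o graph h) theta <> V *m 'D_(delta_mx j 0) (graph h) theta]].

(** Rademacher is applied to the graph of [h], not to [h]: its values lie in the domain of [F],
    where the chain rule of [J] provides derivability almost everywhere of absolutely continuous
    curves. *)
Lemma irregular_null h : locally_lipschitz h -> null_cols (irregular h).
Proof.
move=> hl; have [Jcl _ _ Jchain] := FJ.
have gl : locally_lipschitz (graph h) by exact: locally_lipschitz_graph.
apply: null_colsU.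
  apply: rademacher => // g gac; have := Jchain g gac.
  by apply: negligibleS => t; apply: contra_not => Ht /Ht[].
apply: null_cols_bigcup => j; apply: chain_rule_null => //.
exact: (locally_lipschitz_comp gl Fl).
Qed.

Lemma regular_differentiable h theta : ~ irregular h theta -> differentiable h theta.
Proof.
move=> nirr; have dg : differentiable (graph h) theta.
  by apply: contrapT => nd; apply: nirr; left.
have -> : h = (fun t => usubmx (graph h t)) by apply/funext => t; rewrite col_mxKu.
exact: differentiable_usubmx.
Qed.

Lemma regular_chain_rule h theta j V : ~ irregular h theta ->
  differentiable (F \o graph h) theta -> J (graph h theta) V ->
  'D_(delta_mx j 0) (F \o graph h) theta =
    V *m col_mx ('D_(delta_mx j 0) h theta) (delta_mx j 0).
Proof.
move=> nirr dFg JV; have dh := regular_differentiable nirr.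
have /derivableP /is_derive_graph gh : derivable h theta (delta_mx j 0) by exact: diff_derivable.
rewrite -(@derive_val _ _ _ _ _ _ _ gh).
apply: contrapT => DV; apply: nirr; right; exists j => //; split.
- exact: (@ex_derive _ _ _ _ _ _ _ gh).
- exact: diff_derivable.
- by exists V.
Qed.

Lemma Jacobian_recursion_cvg (x : nat -> 'cV[R]_m -> 'cV[R]_p) xbar theta :
  (forall k, x k.+1 = F \o graph (x k)) -> F \o graph xbar = xbar ->
  x k theta @[k --> \oo] --> xbar theta ->
  (forall k, ~ irregular (x k) theta) -> ~ irregular xbar theta ->
  Jacobian (x k) theta @[k --> \oo] --> Jacobian xbar theta.
Proof.
move=> xS xbarE x_cvg xreg xbarreg; have [Jcl Jbd Jne _] := FJ.
have dx k := regular_differentiable (xreg k).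
have dxbar := regular_differentiable xbarreg.
pose zbar := graph xbar theta; pose z k := graph (x k) theta.
have z_cvg : z k @[k --> \oo] --> zbar.
  apply/cvgrPdist_lt => e e0; have [K _ HK] := (cvgrPdist_lt _ _).1 x_cvg e e0.
  exists K => // k /HK /= H.
  by rewrite /zbar /z /graph col_mxB norm_col_mx subrr normr0 gt_max H.
(* An arbitrary selection; only the defect [V k *m u - D] is shown to tend to 0. *)
have /choice[V JV] : forall k, exists V, J (z k) V by move=> k; exact: Jne.
have Dcvg (j : 'I_m) : norm2 ('D_(delta_mx j 0) (x k) theta - 'D_(delta_mx j 0) xbar theta)
    @[k --> \oo] --> (0 : R).
  set e := delta_mx j 0 : 'cV[R]_m; set D := 'D_e xbar theta.
  pose u := col_mx D e.
  apply: (@contracted_cvg0 _ rho _ (fun k => norm2 (V k *m u - D))) => //.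
  - by move=> k; exact: norm2_ge0.
  - move=> k; have dxS := dx k.+1; rewrite xS in dxS.
    rewrite xS (regular_chain_rule j (xreg k) dxS (JV k)) -/e.
    set Dk := 'D_e (x k) theta.
    have -> : V k *m col_mx Dk e - D = lsubmx (V k) *m (Dk - D) + (V k *m u - D).
      have Vw w : V k *m col_mx w e = lsubmx (V k) *m w + rsubmx (V k) *m e.
        by rewrite -mul_row_col hsubmxK.
      rewrite /u !Vw mulmxBr.
      by apply/matrixP => i c; rewrite !mxE; ring.
    apply: (le_trans (norm2D _ _)); rewrite lerD2r.
    apply: (le_trans (norm2_mulmx_le_opnorm _ _)); rewrite ler_wpM2r ?norm2_ge0 //.
    by apply: (Jrho (B := rsubmx (V k)) (theta := theta) (x := x k theta)); rewrite hsubmxK; exact: JV.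
  - have JD W : J zbar W -> W *m u = D.
      move=> JW; have dFx : differentiable (F \o graph xbar) theta by rewrite xbarE.
      by rewrite -(regular_chain_rule j xbarreg dFx JW) xbarE.
    have [U nU] := Jbd zbar; rewrite /bounded_set /= => /pinfty_ex_gt0[M M0 HM].
    have [K1 _ VM] : \forall k \near \oo, `|V k| <= M.
      by have [K _ HK] := z_cvg _ nU; exists K => // k /HK Uk; apply: HM; exists (z k).
    apply/cvgrPdist_lt => eta eta0.
    have p1 : 0 < p%:R + 1 :> R by rewrite ltr_wpDl.
    (* The factor [p + 1] pays for passing from the max norm to the Euclidean norm. *)
    pose eta' := eta / (p%:R + 1).
    have eta'0 : 0 < eta' by exact: divr_gt0.
    (* Every [W] in [J zbar] satisfies [W *m u = D], so [zbar] avoids the closed set of points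
       carrying a bounded matrix with defect at least [eta']; eventually [z k] avoids it too. *)
    have /open_nbhs_nbhs nbar : open_nbhs zbar
        (~` [set z | exists W, [/\ `|W| <= M, J z W & eta' <= `|W *m u - D|]]).
      split; first by rewrite openC; exact: closed_graph_usc.
      by move=> [W [_ /JD ->]]; rewrite subrr normr0 leNgt eta'0.
    have [K2 _ nk] := z_cvg _ nbar.
    exists (maxn K1 K2) => // k /=; rewrite geq_max => /andP[/VM {}VM /nk {}nk].
    rewrite sub0r normrN ger0_norm ?norm2_ge0 //.
    apply: (le_lt_trans (norm2_le_norm _)).
    have : `|V k *m u - D| < eta' by rewrite ltNge; apply/negP => H; apply: nk; exists (V k).
    by rewrite ltr_pdivlMr //; have := normr_ge0 (V k *m u - D); lra.
apply/(@cvgrPdist_le _ _ _ \oo) => e e0.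
have : \forall k \near \oo, forall j : 'I_m,
    norm2 ('D_(delta_mx j 0) (x k) theta - 'D_(delta_mx j 0) xbar theta) <= e.
  apply: filter_forall => j; have [K _ HK] := (cvgrPdist_le _ _).1 (Dcvg j) _ e0.
  by exists K => // k /HK /=; rewrite sub0r normrN ger0_norm ?norm2_ge0.
move=> [K _ HK]; exists K => // k /HK Hk; apply: mx_norm_le => [|i j]; first exact: ltW.
apply: le_trans (Hk j); apply: le_trans (norm_le_norm2 _).
apply: le_trans (mx_entry_le_norm _ i 0).
by rewrite !mxE distrC.
Qed.

End recursion.

Theorem corollary2 (R : realType) (p m : nat)
    (F : 'cV[R]_(p + m) -> 'cV[R]_p)
    (JF : 'cV[R]_(p + m) -> set 'M[R]_(p, p + m))
    (rho : R) (x0 : 'cV[R]_m -> 'cV[R]_p) :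
  locally_lipschitz F ->
  path_differentiable F ->
  conservative_jacobian F JF ->
  0 <= rho -> rho < 1 ->
  (forall (x : 'cV[R]_p) (theta : 'cV[R]_m)
      (A : 'M[R]_(p, p)) (B : 'M[R]_(p, m)),
    JF (col_mx x theta) (row_mx A B) -> opnorm A <= rho) ->
  lipschitz x0 ->
  exists xbar : 'cV[R]_m -> 'cV[R]_p,
    (forall theta, unique (fun x => F (col_mx x theta) = x) (xbar theta)) /\
    {ae (@lebesgue_tuple R m), forall t : m.-tuple R,
      let theta := col_of_tuple t in
      [/\ forall k, differentiable (iterates F x0 k) theta,
          differentiable xbar theta
        & Jacobian (iterates F x0 k) theta @[k --> \oo]
            --> Jacobian xbar theta]}.
Proof.
move=> Fl _ FJ rho0 rho1 Jrho x0l.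
have /choice[xbar xbarE] := fixed_point_exists Fl FJ rho0 rho1 Jrho.
exists xbar; split.
  move=> theta; split; first exact: xbarE.
  by move=> y Fy; exact: (fixed_point_unique Fl FJ rho0 rho1 Jrho (xbarE theta) Fy).
have xl k : locally_lipschitz (iterates F x0 k).
  elim: k => [|k IH]; first exact: lipschitz_locally_lipschitz.
  exact: (locally_lipschitz_comp (locally_lipschitz_graph IH) Fl).
have xbarl := fixed_point_locally_lipschitz Fl FJ rho0 rho1 Jrho xbarE.
(* A single null set serves all iterates and the fixed point at once. *)
have : null_cols (\bigcup_k irregular F JF (iterates F x0 k) `|` irregular F JF xbar).
  apply: null_colsU; last exact: irregular_null.
  by apply: null_cols_bigcup => k; exact: irregular_null.
move=> [N [mN N0 HN]]; exists N; split => // t nP; apply: HN; apply: contrapT => reg.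
have xreg k : ~ irregular F JF (iterates F x0 k) (col_of_tuple t).
  by move=> irr; apply: reg; left; exists k.
have xbarreg : ~ irregular F JF xbar (col_of_tuple t) by move=> irr; apply: reg; right.
apply: nP; split.
- by move=> k; exact: regular_differentiable (xreg k).
- exact: regular_differentiable xbarreg.
- apply: (Jacobian_recursion_cvg FJ rho0 rho1 Jrho) => //.
    by apply/funext => theta /=; exact: xbarE.
  apply/cvgrPdist_le => e e0.
  set theta := col_of_tuple t.
  have [K HK] := rho_expn_small rho0 rho1 (norm2 (x0 theta - xbar theta)) e0.
  exists K => // k Kk; rewrite distrC; apply: (le_trans (norm_le_norm2 _)).
  apply: le_trans (HK k Kk).
  (* The orbit of [x0 theta] is compared with the constant orbit of the fixed point. *)
  have := iter_contraction Fl FJ rho0 Jrho theta k (xbar theta) (x0 theta).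
  by rewrite [iter k _ (xbar theta)]iter_fix // xbarE.
Qed.
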